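(* Fix $b\ge2$, $\beta\ge0$, $h\in\mathbb{R}$ and a boundary condition $\tau$. (a) For any integer $\ell\ge1$ and any $\delta\in(0,1]$, and any finite complete subtree $T$, if $\mu=\mu_T^\tau$ satisfies $\mathrm{EM}\Bigl(\ell,\bigl[\tfrac{(1-\delta)p_{\min}}{\ell+1-\delta}\bigr]^2\Bigr)$, then $\mathrm{Ent}(f)\le\frac{2}{\delta}\,\mathcal{E}_\ell(f)$ for all $f:\Omega\to[0,\infty)$. (b) In particular, if there are fixed $\ell\ge1$ and $\delta\in(0,1]$ such that $\mu_T^\tau$ satisfies $\mathrm{EM}\Bigl(\ell,\bigl[\tfrac{(1-\delta)p_{\min}}{\ell+1-\delta}\bigr]^2\Bigr)$ for every finite complete subtree $T$, then $c_{\mathrm{sob}}(\mu)=\Omega(1)$, i.e. there is a constant $C>0$ with $c_{\mathrm{sob}}(\mu_T^\tau)\ge1/C$ for every $T$. (c) Conversely, if $c_{\mathrm{sob}}(\mu)=\Omega(1)$, i.e. there is a constant $C>0$ with $c_{\mathrm{sob}}(\mu_T^\tau)\ge1/C$ for every $T$, then there exist constants $c,\vartheta>0$ such that for all $T$ and all $\ell$, $\mu_T^\tau$ satisfies $\mathrm{EM}(\ell,ce^{-\vartheta\ell})$.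
   Context: Setting. Fix an integer $b\ge2$, $\beta\ge0$ (inverse temperature) and $h\in\mathbb{R}$ (external field). $\mathbb{T}^b$ is the infinite rooted tree in which every vertex has $b$ children. $T$ denotes a finite complete subtree: for some vertex $r$ (the root of $T$) and some $m\ge0$, $T$ consists of $r$ and all its descendants at distance at most $m$ from $r$. $\partial T$ is the set of children in $\mathbb{T}^b$ of the leaves of $T$; only edges inside $T\cup\partial T$ are considered. For $A\subseteq T$, $\partial A$ is the set of vertices of $(T\cup\partial T)\setminus A$ adjacent to $A$, and $E(A\cup\partial A)$ is the set of edges with both endpoints in $A\cup\partial A$. A boundary condition is a configuration $\tau\in\{\pm1\}^{\mathbb{T}^b}$; $\Omega=\Omega_T^\tau$ is the set of $\sigma\in\{\pm1\}^{T\cup\partial T}$ agreeing with $\tau$ on $\partial T$. For $\eta\in\Omega$ and $A\subseteq T$, $\mu_A^\eta$ is the probability measure on $\Omega$ with $\mu_A^\eta(\sigma)\propto\exp[\beta(\sum_{xy\in E(A\cup\partial A)}\sigma_x\sigma_y+h\sum_{x\in A}\sigma_x)]$ if $\sigma$ agrees with $\eta$ outside $A$, and $\mu_A^\eta(\sigma)=0$ otherwise. $\mu=\mu_T^\tau$ is the case $A=T$. $\mu_A^\eta(f)$ is the expectation of $f$, $\mathrm{Var}_A^\eta(f)=\mu_A^\eta(f^2)-\mu_A^\eta(f)^2$ and, for $f\ge0$, $\mathrm{Ent}_A^\eta(f)=\mu_A^\eta(f\log f)-\mu_A^\eta(f)\log\mu_A^\eta(f)$; viewed as functions of $\eta$ these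 are written $\mu_A(f),\mathrm{Var}_A(f),\mathrm{Ent}_A(f)$. $\mathrm{Ent}$ without subscripts is with respect to $\mu$. Log-Sobolev constant (heat-bath Glauber dynamics): $\mathcal{D}(f)=\sum_{x\in T}\mu(\mathrm{Var}_{\{x\}}(f))$ and $c_{\mathrm{sob}}(\mu)=\inf_{f\ge0}\mathcal{D}(\sqrt f)/\mathrm{Ent}(f)$ over non-constant $f:\Omega\to[0,\infty)$. Blocks. For $x\in T$, $T_x$ is the subtree of $T$ consisting of $x$ and all its descendants in $T$, $\widetilde{T_x}=T_x\setminus\{x\}$, and $B_{x,\ell}\subseteq T_x$ is the set of vertices of $T_x$ at distance at most $\ell-1$ from $x$ (all of $T_x$ if $T_x$ has fewer than $\ell$ levels). $\mathcal{E}_\ell(f)=\sum_{x\in T}\mu[\mathrm{Ent}_{B_{x,\ell}}(f)]$. $p_{\min}=\min_{x\in T,\,s\in\{+,-\},\,\eta\in\Omega_T^\tau}\mu^\eta_{T_x}(\sigma_x=s)$, which is bounded below by $\frac12e^{-2\beta(b+|h|)}$. Entropy Mixing. $\mu=\mu_T^\tau$ satisfies $\mathrm{EM}(\ell,\varepsilon)$ if for every $x\in T$, every $\eta\in\Omega_T^\tau$ and every non-negative function $f$ on $\Omega$ that does not depend on the spins in $B_{x,\ell}$, one has $\mathrm{Ent}^\eta_{T_x}[\mu_{\widetilde{T_x}}(f)]\le\varepsilon\,\mathrm{Ent}^\eta_{T_x}(f)$. *)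

(* Defs.v *)
From HB Require Import structures.
From mathcomp Require Import all_boot all_order all_algebra.
From mathcomp Require Import classical_sets reals sequences exp.

Set Implicit Arguments.
Unset Strict Implicit.
Unset Printing Implicit Defensive.

Import Order.TTheory GRing.Theory Num.Theory.

Local Open Scope ring_scope.

(* A vertex of the infinite rooted b-ary tree is the word of child indices read
   along the path from the root: [::] is the root, the children of x are the
   words rcons x i with i : 'I_b, and y is x or a descendant of x iff
   prefix x y. *)
Definition tree (b : nat) := seq 'I_b.

(* T is the complete subtree with root r and depth m. A vertex of T \cup dT is
   r ++ w with size w <= m.+1; it is represented by the word w alone, so that
   r only matters in reading off the boundary condition. Spins are booleans,
   true standing for +1 and false for -1. *)
Definition vertex (b m : nat) := m.+1.-bseq 'I_b.

Section Geometry.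
Variables b m : nat.
Implicit Types (x y : vertex b m) (A : {set vertex b m}).

Definition subtree : {set vertex b m} := [set x : vertex b m | (size x <= m)%N].

Definition outer_boundary : {set vertex b m} := [set x : vertex b m | size x == m.+1].

Definition child x y : bool := [exists i : 'I_b, y == rcons x i :> seq 'I_b].

Definition adjacent x y : bool := child x y || child y x.

Definition boundary A : {set vertex b m} :=
  [set y | (y \notin A) && [exists x in A, adjacent x y]].

Definition subtree_at x : {set vertex b m} :=
  [set y in subtree | prefix x y].

Definition subtree_below x : {set vertex b m} := subtree_at x :\ x.

(* The distance size y - size x is at most l - 1. *)
Definition block x (l : nat) : {set vertex b m} :=
  [set y in subtree_at x | (size y < size x + l)%N].

End Geometry.

Arguments subtree {b m}.
Arguments outer_boundary {b m}.

Section Configurations.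
Variables (b : nat) (tau : tree b -> bool) (r : tree b) (m : nat).

Definition agrees_with_tau (s : {ffun vertex b m -> bool}) : bool :=
  [forall x in outer_boundary, s x == tau (r ++ x)].

Record config := Config {
  spins :> {ffun vertex b m -> bool};
  configP : agrees_with_tau spins }.

HB.instance Definition _ := [isSub for spins].
HB.instance Definition _ := [Finite of config by <:].

Fact restriction_subproof :
  agrees_with_tau [ffun x : vertex b m => tau (r ++ x)].
Proof. by apply/forall_inP => x _; rewrite ffunE. Qed.

Definition restriction : config := Config restriction_subproof.

Definition agree_outside (A : {set vertex b m}) (s s' : config) : bool :=
  [forall x, (x \notin A) ==> (s x == s' x)].

End Configurations.

Section Ising.
Variables (R : realType) (b : nat) (beta h : R) (tau : tree b -> bool).
Variables (r : tree b) (m : nat).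

Local Notation V := (vertex b m).
Local Notation Omega := (config tau r m).

Implicit Types (A : {set V}) (eta s : Omega) (f : Omega -> R).

Definition spin (e : bool) : R := if e then 1 else -1.

(* Each edge is counted once, as a pair (parent, child). *)
Definition energy A s : R :=
  (\sum_(x in A :|: boundary A) \sum_(y in A :|: boundary A | child x y)
      spin (s x) * spin (s y))
  + h * \sum_(x in A) spin (s x).

Definition weight A s : R := expR (beta * energy A s).

Definition gibbs A eta s : R :=
  if agree_outside A s eta
  then weight A s / \sum_(s' : Omega | agree_outside A s' eta) weight A s'
  else 0.

Definition prob A eta (P : pred Omega) : R := \sum_(s | P s) gibbs A eta s.

Definition mean A f eta : R := \sum_s gibbs A eta s * f s.

Definition Var A f eta : R :=
  mean A (fun s => f s ^+ 2) eta - mean A f eta ^+ 2.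

(* 0 * ln 0 = 0, which is the usual convention for entropies. *)
Definition Ent A f eta : R :=
  mean A (fun s => f s * ln (f s)) eta - mean A f eta * ln (mean A f eta).

Definition mean_T f : R := mean subtree f (restriction tau r m).

Definition Ent_T f : R := Ent subtree f (restriction tau r m).

Definition dirichlet f : R := \sum_(x in subtree) mean_T (Var [set x] f).

Definition block_entropy (l : nat) f : R :=
  \sum_(x in subtree) mean_T (Ent (block x l) f).

(* The set is nonempty and bounded below by 0 and, the weights being positive,
   Ent_T f > 0 for nonconstant f >= 0; hence neither the default value of inf
   nor that of the division matters. *)
Definition csob : R :=
  inf [set q | exists f : Omega -> R,
         [/\ forall s, 0 <= f s,
             exists s s', f s <> f s' &
             q = dirichlet (fun s => Num.sqrt (f s)) / Ent_T f]]%classic.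

(* The default value 1 is harmless, since probabilities are at most 1. *)
Definition pmin : R :=
  \big[Num.min/1]_(x in @subtree b m) \big[Num.min/1]_(e : bool)
    \big[Num.min/1]_(eta : Omega)
      prob (subtree_at x) eta (fun s => s x == e).

Definition independent_of A f : Prop :=
  forall s s', agree_outside A s s' -> f s = f s'.

Definition entropy_mixing (l : nat) (eps : R) : Prop :=
  forall (x : V) (eta : Omega) (f : Omega -> R),
    x \in subtree -> (forall s, 0 <= f s) -> independent_of (block x l) f ->
    Ent (subtree_at x) (mean (subtree_below x) f) eta
      <= eps * Ent (subtree_at x) f eta.

End Ising.

(* Main.v *)
(* Averaging over a set of sites is a conditional expectation, and averages over
   sets without common or adjacent sites commute.  This gives the chain rule, the
   tensorization and the superadditivity of the entropy over disjoint subtrees.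

   For (a), let [phi] be the average of [f] over the proper descendants of [x].
   The variational formula for the entropy and [ln k <= k - 1] bound [Ent phi] by
   the mean entropy of [f] in the block plus the covariance of two functions of
   the spin at [x] alone.  For functions of one spin, Pinsker's inequality bounds
   the variance by the entropy with constant [1 / pmin], and entropy mixing makes
   the covariance small.  Applied after averaging [f] over the sites at distance
   more than [l] from [x], and summed over [x], the error terms are absorbed.

   For (b), a block has boundedly many sites and boundedly many boundary
   interactions, so it satisfies a logarithmic Sobolev inequality with a uniform
   constant.

   For (c), let [f_j] be the average of [f] over the sites at distance more than
   [j] from [x].  Flipping a spin [y] at distance [j] only changes, by a bounded
   density, the law of the subtree below [y], so the squared increment of
   [sqrt f_j] is at most a constant times the entropy of the average of [f] over
   the other subtrees; these entropies add up to at most the conditional entropy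
   [Ent f_(j+1) - Ent f_j].  The logarithmic Sobolev inequality for the subtree at
   [x] (the spin of the parent of [x] costs a bounded factor) then yields
   [Ent f_j <= L (Ent f_(j+1) - Ent f_j)], hence geometric decay. *)

From mathcomp Require Import classical_sets reals topology normedtype sequences derive exp.
From HB Require Import structures.
From mathcomp Require Import all_boot all_order all_algebra.
From mathcomp Require Import ring lra.
Require Import Defs.

Set Implicit Arguments.
Unset Strict Implicit.
Unset Printing Implicit Defensive.

Import Order.TTheory GRing.Theory Num.Theory.
Import numFieldNormedType.Exports.

Local Open Scope ring_scope.

(** * Logarithmic inequalities and Pinsker's inequality on two points *)

Section RealInequalities.
Variable R : realType.
Implicit Types (a p q t u v : R).

(** This is [ln t <= t - 1] at [t = v / u], multiplied by [u]. *)
Lemma sub_le_mulr_subln u v : 0 <= u -> 0 < v -> u - v <= u * (ln u - ln v).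
Proof.
rewrite le_eqVlt => /predU1P[<-|u0] v0; first by rewrite mul0r sub0r oppr_le0 ltW.
have vu0 : 0 < v / u by rewrite divr_gt0.
have := @le_ln1Dx _ (v / u - 1).
have -> : 1 + (v / u - 1) = v / u by ring.
rewrite ltrBDl subrr ln_div // => /(_ vu0) H.
have : u * (ln v - ln u) <= u * (v / u - 1) by rewrite ler_pM2l.
have -> : u * (v / u - 1) = v - u by field; rewrite gt_eqF.
lra.
Qed.

(** Apply the previous inequality to [x = sqrt u] and [y = sqrt v] and multiply by [2 x]; then
    $2x(x-y) = (x-y)^2 + x^2 - y^2$. This is the pointwise form of the bound of the Hellinger
    distance by the relative entropy. *)
Lemma sqr_subsqrt_le u v : 0 <= u -> 0 < v ->
  (Num.sqrt u - Num.sqrt v) ^+ 2 <= u * (ln u - ln v) - u + v.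
Proof.
rewrite le_eqVlt => /predU1P[<-|u0] v0.
  by rewrite sqrtr0 mul0r sub0r sqrrN (sqr_sqrtr (ltW v0)); lra.
have su : 0 < Num.sqrt u by rewrite sqrtr_gt0.
have sv : 0 < Num.sqrt v by rewrite sqrtr_gt0.
have lnsqrt (w : R) : 0 < w -> ln w = ln (Num.sqrt w) + ln (Num.sqrt w).
  by move=> w0; rewrite -lnM ?posrE ?sqrtr_gt0// -expr2 sqr_sqrtr 1?ltW.
have H := sub_le_mulr_subln (ltW su) sv.
rewrite (lnsqrt u u0) (lnsqrt v v0).
have uE := sqr_sqrtr (ltW u0); have vE := sqr_sqrtr (ltW v0).
move: uE vE su sv H; set x := Num.sqrt u; set y := Num.sqrt v => uE vE x0 y0 H.
have : x * (x - y) <= x * (x * (ln x - ln y)) by rewrite ler_pM2l.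
rewrite mulrA -expr2 uE -uE -vE; lra.
Qed.

(* As a function of [t], the derivative of the difference of the two sides is
   [(t - a) * ((t * (1 - t))^-1 - 4)], nonnegative on the right of [a]. *)
Lemma binary_pinsker_right a p : 0 <= a -> a <= p -> p < 1 ->
  2 * (a - p) ^+ 2 <= a * (ln a - ln p) + (1 - a) * (ln (1 - a) - ln (1 - p)).
Proof.
move=> a0 ap p1.
pose F := fun t : R => - (a * ln t + (1 - a) * ln (1 - t) + 2 * (t - a) ^+ 2).
suff : F a <= F p by rewrite /F; lra.
have dF t : 0 < t -> t < 1 ->
    is_derive t (1 : R) F (- (a * t^-1 - (1 - a) * (1 - t)^-1 + 4 * (t - a))).
  move=> t0 t1; have t1' : 0 < 1 - t by rewrite subr_gt0.
  have d1 := is_derive1_ln t0.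
  have d2 := is_derive1_ln t1'.
  rewrite /F; apply: is_derive_eq => /=.
  rewrite !(scaler0, addr0, add0r) /GRing.scale /=; ring.
have dF0 t : 0 < t -> t < 1 -> a <= t -> 0 <= derive1 F t.
  move=> t0 t1 at_; rewrite derive1E; have [_ ->] := dF t t0 t1.
  have -> : - (a * t^-1 - (1 - a) * (1 - t)^-1 + 4 * (t - a)) =
      (t - a) * (1 - 2 * t) ^+ 2 / (t * (1 - t)).
    by field; rewrite subr_eq0 [1 == t]eq_sym (lt_eqF t1) gt_eqF.
  apply: divr_ge0; first by apply: mulr_ge0; [rewrite subr_ge0|exact: sqr_ge0].
  by apply: mulr_ge0; rewrite ?subr_ge0 ltW.
apply: (@ger0_derive1_le_cc _ F a p) => //.
- move=> t; rewrite in_itv/= => /andP[? ?].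
  have t0 : 0 < t by lra.
  have t1 : t < 1 by lra.
  by have [] := dF t t0 t1.
- move=> t; rewrite in_itv/= => /andP[at_ tp]; apply: dF0 (ltW at_).
    exact: le_lt_trans at_.
  exact: lt_trans p1.
- apply: derivable_within_continuous => t; rewrite in_itv/= => /andP[? ?].
  (* At [a = 0] the interval contains the singularity of [ln] at 0, but there the term [a * ln t]
     vanishes identically. *)
  move: a0; rewrite le_eqVlt => /predU1P[a0|a0]; last first.
    have t0 : 0 < t by lra.
    have t1 : t < 1 by lra.
    by have [] := dF t t0 t1.
  have t1' : 0 < 1 - t by lra.
  have d2 := is_derive1_ln t1'.
  have -> : F = fun t => - (ln (1 - t) + 2 * t ^+ 2).
    by apply/boolp.funext => z; rewrite /F -a0 mul0r add0r !subr0 mul1r.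
  by [].
- by rewrite in_itv/= lexx.
- by rewrite in_itv/= lexx andbT.
Qed.

Lemma binary_pinsker a p : 0 <= a <= 1 -> 0 < p < 1 ->
  2 * (a - p) ^+ 2 <= a * (ln a - ln p) + (1 - a) * (ln (1 - a) - ln (1 - p)).
Proof.
move=> /andP[a0 a1] /andP[p0 p1]; have [ap|pa] := leP a p.
  exact: binary_pinsker_right.
have := @binary_pinsker_right (1 - a) (1 - p).
rewrite !subKr => /(_ _ _ _); lra.
Qed.

(** With [N] the mean, [a = p u / N] is the mass of the first point after tilting by the density.
    The entropy divided by [N] is the relative entropy of [a] to [p], and $aN - pN = pq(u-v)$, so
    Pinsker's inequality bounds the variance. The larger of [p] and [q] is at least 1/2, hence
    [2 p q >= pm]. *)
Lemma two_point_variance_le_entropy (pm p q u v : R) :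
    0 < p -> 0 < q -> p + q = 1 -> pm <= p -> pm <= q -> 0 <= u -> 0 <= v ->
  pm * (p * q * (u - v) ^+ 2) <= (p * u + q * v) *
    (p * (u * ln u) + q * (v * ln v) - (p * u + q * v) * ln (p * u + q * v)).
Proof.
move=> p0 q0 pq pmp pmq u0 v0; set N := p * u + q * v; rewrite /=.
have N0 : 0 <= N by rewrite addr_ge0 ?mulr_ge0// ltW.
move: (N0); rewrite le_eqVlt => /predU1P[NE|Ngt].
  have /eqP : N = 0 by [].
  rewrite paddr_eq0 ?mulr_ge0 ?(ltW p0) ?(ltW q0)// !mulf_eq0.
  rewrite (gt_eqF p0) (gt_eqF q0) /= => /andP[/eqP -> /eqP ->].
  by rewrite -NE; lra.
pose a := p * u / N.
have aN : a * N = p * u by rewrite /a divfK ?gt_eqF.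
have aN' : (1 - a) * N = q * v by rewrite mulrBl aN mul1r /N; lra.
have a0 : 0 <= a by rewrite divr_ge0 ?mulr_ge0 ?(ltW p0).
have a1 : 0 <= 1 - a by rewrite -(pmulr_lge0 _ Ngt) aN' mulr_ge0 // ltW.
have qE : 1 - p = q by lra.
have := @binary_pinsker a p; rewrite qE => /(_ _ _)H.
have {}H : 2 * (a - p) ^+ 2 <= a * (ln a - ln p) + (1 - a) * (ln (1 - a) - ln q).
  by apply: H; lra.
have lnE c w r : 0 < r -> 0 <= w -> c * N = r * w ->
    c * N * (ln c - ln r) = r * w * (ln w - ln N).
  move=> r0; rewrite le_eqVlt => /predU1P[<-|w0] E; first by rewrite E mulr0 !mul0r.
  have c0 : 0 < c by rewrite -(pmulr_lgt0 _ Ngt) E mulr_gt0.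
  have : ln (c * N) = ln (r * w) by rewrite E.
  rewrite !lnM ?posrE// E => ?; congr (_ * _); lra.
have HN : N * N * (2 * (a - p) ^+ 2) <= N * (p * u * (ln u - ln N) + q * v * (ln v - ln N)).
  rewrite -(lnE a u p)// -(lnE (1 - a) v q)// -mulrA ler_pM2l//.
  rewrite -!(mulrAC _ _ N) -mulrDl mulrC ler_pM2r//.
have -> : N * (p * (u * ln u) + q * (v * ln v) - N * ln N) =
   N * (p * u * (ln u - ln N) + q * v * (ln v - ln N)) by rewrite /N; ring.
apply: le_trans HN.
have -> : N * N * (2 * (a - p) ^+ 2) = 2 * (a * N - p * N) ^+ 2 by ring.
rewrite aN.
have -> : p * u - p * N = p * q * (u - v).
  by rewrite /N -qE; ring.
have -> : 2 * (p * q * (u - v)) ^+ 2 = (2 * (p * q)) * (p * q * (u - v) ^+ 2) by ring.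
apply: ler_wpM2r; first by rewrite mulr_ge0 ?sqr_ge0// mulr_ge0// ltW.
have [pq2|/ltW pq2] := leP p q.
  by apply: le_trans pmp _; rewrite mulrCA -[leLHS]mulr1 ler_pM2l//; lra.
by apply: le_trans pmq _; rewrite mulrA -[leLHS]mul1r ler_pM2r//; lra.
Qed.

End RealInequalities.

(** * Configurations, and dependence of functions on sets of sites *)

Section Gibbs.
Variables (R : realType) (b : nat) (beta h : R) (tau : tree b -> bool).
Variables (r : tree b) (m : nat).

Local Notation V := (vertex b m).
Local Notation Omega := (config tau r m).
Local Notation W := (weight beta h [set: V]).
Local Notation mu := (mean beta h).
Local Notation ent := (Ent beta h).

Implicit Types (x y : V) (A B D U : {set V}) (eta s t : Omega) (f g : Omega -> R).

Lemma agree_outsideP A s t :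
  reflect (forall x, x \notin A -> s x = t x) (agree_outside A s t).
Proof. by apply: (iffP forall_inP) => H x xA; apply/eqP; apply: H. Qed.

Lemma agree_outside_refl A s : agree_outside A s s.
Proof. exact/agree_outsideP. Qed.

Lemma agree_outside_sym A s t : agree_outside A s t = agree_outside A t s.
Proof. by apply: eq_forallb => x; rewrite eq_sym. Qed.

Lemma agree_outside_trans A s t u :
  agree_outside A s t -> agree_outside A t u -> agree_outside A s u.
Proof.
move=> /agree_outsideP H1 /agree_outsideP H2; apply/agree_outsideP => x xA.
by rewrite H1 ?H2.
Qed.

Lemma agree_outsideS A B s t :
  A \subset B -> agree_outside A s t -> agree_outside B s t.
Proof.
move=> /fintype.subsetP AB /agree_outsideP H; apply/agree_outsideP => x xB.
by apply: H; apply: contra xB; apply: AB.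
Qed.

Lemma agree_outside_subl A s t u :
  agree_outside A s t -> agree_outside A s u = agree_outside A t u.
Proof.
move=> st; apply/idP/idP; last exact: agree_outside_trans.
by apply: agree_outside_trans; rewrite agree_outside_sym.
Qed.

Lemma agree_outside_subr A s t u :
  agree_outside A s t -> agree_outside A u s = agree_outside A u t.
Proof. by rewrite !(agree_outside_sym _ u); exact: agree_outside_subl. Qed.

Lemma config_eqP s t : (forall x, s x = t x) -> s = t.
Proof. by move=> H; apply/val_inj/ffunP. Qed.

Fact patch_subproof A s t :
  agrees_with_tau tau r [ffun x => if x \in A then s x else t x].
Proof.
apply/forall_inP => x xb; rewrite ffunE; case: ifP => _.
  by have /forall_inP/(_ x xb) := configP s.
by have /forall_inP/(_ x xb) := configP t.
Qed.

Definition patch A s t : Omega := Config (patch_subproof A s t).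

Lemma patchE A s t x : patch A s t x = if x \in A then s x else t x.
Proof. by rewrite /= ffunE. Qed.

Lemma patch_agree A s t : agree_outside A (patch A s t) t.
Proof. by apply/agree_outsideP => x /negPf xA; rewrite patchE xA. Qed.

(** Outside [subtree] only the outer boundary remains, where both equal [tau]; so averages over
    [subtree] do not depend on the reference configuration. *)
Lemma agree_outside_subtree s t : agree_outside subtree s t.
Proof.
apply/agree_outsideP => x; rewrite inE -ltnNge => xm.
have xb : x \in outer_boundary by rewrite inE eqn_leq size_bseq xm.
have /forall_inP/(_ x xb)/eqP -> := configP s.
by have /forall_inP/(_ x xb)/eqP -> := configP t.
Qed.

Lemma indep_sub A B f : A \subset B -> independent_of B f -> independent_of A f.
Proof. by move=> AB H s t /(agree_outsideS AB); apply: H. Qed.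

Lemma indepU A B f :
  independent_of A f -> independent_of B f -> independent_of (A :|: B) f.
Proof.
move=> fA fB s t /agree_outsideP H.
rewrite -(fA (patch A t s)) ?patch_agree//; apply: fB.
apply/agree_outsideP => x xB; rewrite patchE; case: ifP => // xA.
by apply: H; rewrite inE xA.
Qed.

(** The spins of [A] are changed one at a time, each change costing at most [k]. The bound is needed
    only along configurations that still agree with [s] outside [A]. *)
Lemma lipschitz_chain A (Phi : Omega -> R) (k : R) s t :
    (forall y u v, y \in A -> agree_outside A u s -> agree_outside [set y] u v ->
       Phi u - Phi v <= k) ->
  agree_outside A s t -> Phi s - Phi t <= #|A|%:R * k.
Proof.
move: {2}#|A| (erefl #|A|) => n; elim: n A s => [|n IH] A s cA H.
  move/eqP: cA; rewrite cards_eq0 => /eqP ->; rewrite cards0 mul0r => /agree_outsideP st.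
  by rewrite (@config_eqP s t) ?subrr// => x; apply: st; rewrite inE.
have [y yA] : exists y, y \in A by apply/set0Pn; rewrite -cards_eq0 cA.
have cA' : #|A :\ y| = n by move: cA; rewrite (cardsD1 y) yA => -[].
move=> st; rewrite cA -natr1 mulrDl mul1r.
have ys : agree_outside [set y] (patch [set y] t s) s by exact: patch_agree.
have H1 : Phi s - Phi (patch [set y] t s) <= k.
  by apply: (H y) => //; [exact: agree_outside_refl|rewrite agree_outside_sym].
have H2 : Phi (patch [set y] t s) - Phi t <= n%:R * k.
  rewrite -cA'; apply: IH => //.
    move=> z u v /setD1P[_ zA] us uv; apply: (H z) => //.
    apply: agree_outside_trans (agree_outsideS (subsetDl _ _) us) _.
    by apply: agree_outsideS ys; rewrite sub1set.
  apply/agree_outsideP => z; rewrite in_setD1 negb_and negbK patchE in_set1.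
  by case: eqP => //= _ zA; move/agree_outsideP: st; apply.
lra.
Qed.

(** * Locality of the energy and its variation under one spin flip *)

Section Energy.

Local Notation edges A := (fun p : V * V =>
  [&& p.1 \in A :|: boundary A, p.2 \in A :|: boundary A & child p.1 p.2]).

Lemma energyE A s : energy h A s =
  (\sum_(p : V * V | edges A p) spin R (s p.1) * spin R (s p.2))
  + h * \sum_(x in A) spin R (s x).
Proof.
by rewrite /energy pair_big_dep.
Qed.

Lemma energyTE s : energy h [set: V] s =
  (\sum_(p : V * V | child p.1 p.2) spin R (s p.1) * spin R (s p.2))
  + h * \sum_x spin R (s x).
Proof.
rewrite energyE; congr (_ + _ * _); last by apply: eq_bigl => p; rewrite !inE.
by apply: eq_bigl => p; rewrite !inE.
Qed.

Lemma edge_inside A x y : child x y -> (x \in A) || (y \in A) ->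
  (x \in A :|: boundary A) && (y \in A :|: boundary A).
Proof.
move=> xy; rewrite !inE; case xA : (x \in A); case yA : (y \in A) => //= _.
  by apply/exists_inP; exists x => //; rewrite /adjacent xy.
by rewrite andbT; apply/exists_inP; exists y => //; rewrite /adjacent xy orbT.
Qed.

(** What the full energy has beyond that of [A] comes from edges without endpoint in [A] and from
    the field off [A], where [s] and [t] coincide. This is what lets all kernels share the weight of
    the whole vertex set. *)
Lemma energyT_sub A s t : agree_outside A s t ->
  energy h [set: V] s - energy h A s = energy h [set: V] t - energy h A t.
Proof.
move=> /agree_outsideP st.
have dE (u : Omega) : energy h [set: V] u - energy h A u =
  (\sum_(p : V * V | child p.1 p.2 && ~~ edges A p) spin R (u p.1) * spin R (u p.2))
  + h * \sum_(x | x \notin A) spin R (u x).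
  rewrite energyTE energyE (bigID (fun p => edges A p)) /= (bigID (mem A) predT) /=.
  rewrite (eq_bigl (edges A)) => [|p]; last by case: child; rewrite ?andbT ?andbF.
  by ring.
rewrite !dE; congr (_ + _ * _); last by apply: eq_bigr => x xA; rewrite st.
apply: eq_bigr => -[x y] /= /andP[xy].
rewrite xy andbT => H.
have /norP[xA yA] : ~~ ((x \in A) || (y \in A)) by apply: contra H; apply: edge_inside.
by rewrite !st.
Qed.

Lemma spinN e e' : `|spin R e - spin R e'| <= 2.
Proof. by case: e; case: e'; rewrite /spin ler_norml; apply/andP; split; lra. Qed.

Lemma spinM_sub_le e1 e2 e1' e2' :
  `|spin R e1 * spin R e2 - spin R e1' * spin R e2'| <= 2.
Proof.
by case: e1; case: e2; case: e1'; case: e2'; rewrite /spin ler_norml; apply/andP; split; lra.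
Qed.

Lemma sum_children_le y : \sum_(z : V | child y z) (1 : R) <= b%:R.
Proof.
apply: (@le_trans _ _ (\sum_(z : V) \sum_(i : 'I_b) (z == rcons y i :> seq _)%:R)).
  rewrite big_mkcond; apply: ler_sum => z _; case: ifP => [/existsP[i yz]|_].
    by rewrite (bigD1 i)//= yz lerDl sumr_ge0.
  exact: sumr_ge0.
rewrite exchange_big /= -[leRHS](_ : \sum_(i : 'I_b) 1 = _); last first.
  by rewrite sumr_const card_ord.
apply: ler_sum => i _; case: (pickP (fun z : V => z == rcons y i :> seq _)) => [z0 /eqP z0E|H].
  rewrite (bigD1 z0)//= z0E eqxx big1 ?addr0// => z zz0.
  by case: eqP => // zE; case/eqP: zz0; apply/val_inj; rewrite /= zE.
by rewrite big1// => z _; rewrite H.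
Qed.

Lemma child_inj x y z : child x z -> child y z -> x = y.
Proof.
move=> /existsP[i /eqP zi] /existsP[j]; rewrite zi eqseq_rcons => /andP[/eqP xy _].
exact/val_inj.
Qed.

Lemma sum_parents_le y : \sum_(z : V | child z y) (1 : R) <= 1.
Proof.
case: (pickP (fun z : V => child z y)) => [z0 z0y|H]; last by rewrite big_pred0// ler01.
rewrite (bigD1 z0)//= big1 ?addr0// => z /andP[zy].
by rewrite (child_inj zy z0y) eqxx.
Qed.

(** Bound on the energy change at one site: at most [b] edges to children and one to the parent,
    each changing by at most 2, and a field term changing by at most [2 |h|]. *)
Definition site_bound : R := 2 * b%:R + 2 + 2 * `|h|.

Lemma site_bound_ge0 : 0 <= site_bound.
Proof. by rewrite /site_bound !addr_ge0 ?mulr_ge0. Qed.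

Lemma sum_edges_from_le y :
  \sum_(p : V * V | child p.1 p.2) (if p.1 == y then 2 else 0 : R) <= 2 * b%:R.
Proof.
rewrite -(pair_big_dep predT (fun u v => child u v) (fun u v => if u == y then 2 else 0)) /=.
rewrite (bigD1 y)//= [X in _ + X]big1 ?addr0 => [|z /negPf zy]; last by rewrite zy big1.
rewrite eqxx; have := sum_children_le y.
under [X in _ -> X <= _]eq_bigr do rewrite -[2]mulr1.
by rewrite -mulr_sumr => H; rewrite ler_pM2l.
Qed.

Lemma sum_edges_to_le y :
  \sum_(p : V * V | child p.1 p.2) (if p.2 == y then 2 else 0 : R) <= 2.
Proof.
rewrite -(pair_big_dep predT (fun u v => child u v) (fun u v => if v == y then 2 else 0)) /=.
rewrite (exchange_big_dep predT) //= (bigD1 y)//= [X in _ + X]big1 ?addr0 => [|z /negPf zy]; last first.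
  by rewrite zy big1.
rewrite eqxx; have := sum_parents_le y.
under [X in _ -> X <= _]eq_bigr do rewrite -[2]mulr1.
by rewrite -mulr_sumr => H; rewrite -[leRHS]mulr1 ler_pM2l.
Qed.

Lemma energy_lipschitz A y s t : agree_outside [set y] s t ->
  energy h A s - energy h A t <= site_bound.
Proof.
move=> /agree_outsideP st; rewrite !energyE.
set S1 := \sum_(p | _) _; set S2 := \sum_(x in _) _.
set T1 := \sum_(p | _) _; set T2 := \sum_(x in _) _.
have H2 : `|h * (S2 - T2)| <= 2 * `|h|.
  rewrite normrM mulrC ler_wpM2r// -sumrB big_mkcond (bigD1 y)//= big1 => [|z zy].
    by rewrite addr0; case: ifP => _; rewrite ?normr0 ?spinN.
  by rewrite st ?subrr ?if_same// in_set1.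
have H1 : S1 - T1 <= 2 * b%:R + 2.
  rewrite -sumrB; apply: le_trans (lerD (sum_edges_from_le y) (sum_edges_to_le y)).
  rewrite -big_split big_mkcond [leRHS]big_mkcond /=; apply: ler_sum => -[u v] _ /=.
  have ge0 z : 0 <= (if z == y then 2 else 0 : R) by case: ifP.
  case: ifP => [/and3P[_ _ ->]|_]; last by case: ifP => // _; rewrite addr_ge0.
  have [->|uy] := eqVneq u y.
    by rewrite (le_trans (ler_norm _))// (le_trans (spinM_sub_le _ _ _ _))// lerDl.
  have [->|vy] := eqVneq v y.
    by rewrite (le_trans (ler_norm _))// (le_trans (spinM_sub_le _ _ _ _))// lerDr.
  by rewrite !st ?in_set1// subrr addr0.
have := ler_norm (h * (S2 - T2)); rewrite /site_bound; lra.
Qed.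

End Energy.

(** * Gibbs kernels as conditional expectations *)

Lemma weight_gt0 A s : 0 < weight beta h A s.
Proof. exact: expR_gt0. Qed.
Hint Resolve weight_gt0 : core.

Lemma weight_ge0 A s : 0 <= weight beta h A s.
Proof. exact/ltW. Qed.
Hint Resolve weight_ge0 : core.

Lemma weightT_cross A s t : agree_outside A s t ->
  weight beta h A s * W t = weight beta h A t * W s.
Proof.
move=> /energyT_sub E; rewrite /weight -!expRD -!mulrDr; congr (expR (_ * _)); lra.
Qed.

(** The sum uses the weight of the whole vertex set: its ratio to [weight beta h A] is constant on
    configurations agreeing outside [A], so the kernel is unchanged and kernels for different sets
    become comparable. *)
Definition partition_function A eta := \sum_(s | agree_outside A s eta) W s.

Lemma partition_function_gt0 A eta : 0 < partition_function A eta.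
Proof.
rewrite /partition_function (bigD1 eta) ?agree_outside_refl//=.
by rewrite ltr_wpDr// sumr_ge0.
Qed.
Hint Resolve partition_function_gt0 : core.

Lemma gibbsE A eta s : gibbs beta h A eta s =
  if agree_outside A s eta then W s / partition_function A eta else 0.
Proof.
rewrite /gibbs; case: ifP => // sE.
have wE t : agree_outside A t eta ->
    weight beta h A t = W t * (weight beta h A eta / W eta).
  by move=> /weightT_cross H; rewrite mulrA [W t * _]mulrC -H mulfK// gt_eqF.
rewrite (eq_bigr _ wE) -mulr_suml wE// -/(partition_function A eta).
by field; rewrite !gt_eqF.
Qed.

Lemma meanE A f eta : mu A f eta =
  (\sum_(s | agree_outside A s eta) W s * f s) / partition_function A eta.
Proof.
rewrite /mean mulr_suml [RHS]big_mkcond /=; apply: eq_bigr => s _.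
by rewrite gibbsE; case: ifP => _; rewrite ?mul0r// mulrAC.
Qed.

Lemma mean_weightE A f eta : mu A f eta =
  (\sum_(s | agree_outside A s eta) weight beta h A s * f s) /
  \sum_(s | agree_outside A s eta) weight beta h A s.
Proof.
rewrite /mean mulr_suml [RHS]big_mkcond /=; apply: eq_bigr => s _.
by rewrite /gibbs; case: ifP => _; rewrite ?mul0r// mulrAC.
Qed.

Lemma gibbs_ge0 A eta s : 0 <= gibbs beta h A eta s.
Proof. by rewrite gibbsE; case: ifP => // _; rewrite divr_ge0 ?ltW. Qed.
Hint Resolve gibbs_ge0 : core.

Lemma gibbs_gt0 A eta s : agree_outside A s eta -> 0 < gibbs beta h A eta s.
Proof. by rewrite gibbsE => ->; rewrite divr_gt0. Qed.

Lemma sum_gibbs A eta : \sum_s gibbs beta h A eta s = 1.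
Proof.
have := meanE A (fun=> 1) eta; rewrite /mean.
under eq_bigr do rewrite mulr1.
under [X in _ = X / _ -> _]eq_bigr do rewrite mulr1.
by move=> ->; rewrite -/(partition_function A eta) divff ?gt_eqF.
Qed.

Lemma eq_mean A f g eta :
  (forall s, agree_outside A s eta -> f s = g s) -> mu A f eta = mu A g eta.
Proof. by move=> fg; rewrite !meanE; congr (_ / _); apply: eq_bigr => s /fg ->. Qed.

Lemma ler_mean A f g eta :
  (forall s, agree_outside A s eta -> f s <= g s) -> mu A f eta <= mu A g eta.
Proof.
move=> fg; rewrite !meanE ler_pM2r ?invr_gt0//.
by apply: ler_sum => s /fg; rewrite ler_pM2l.
Qed.

Lemma mean_cst A c eta : mu A (fun=> c) eta = c.
Proof. by rewrite /mean -mulr_suml sum_gibbs mul1r. Qed.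

Lemma meanD A f g eta : mu A (fun s => f s + g s) eta = mu A f eta + mu A g eta.
Proof. by rewrite /mean -big_split; apply: eq_bigr => s _; rewrite mulrDr. Qed.

Lemma meanZ A c f eta : mu A (fun s => c * f s) eta = c * mu A f eta.
Proof. by rewrite /mean mulr_sumr; apply: eq_bigr => s _; rewrite mulrCA. Qed.

Lemma meanB A f g eta : mu A (fun s => f s - g s) eta = mu A f eta - mu A g eta.
Proof. by rewrite /mean -sumrB; apply: eq_bigr => s _; rewrite mulrBr. Qed.

Lemma mean_sum A I (l : seq I) (P : pred I) (F : I -> Omega -> R) eta :
  mu A (fun s => \sum_(i <- l | P i) F i s) eta = \sum_(i <- l | P i) mu A (F i) eta.
Proof.
rewrite /mean; under eq_bigr do rewrite mulr_sumr.
by rewrite exchange_big.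
Qed.

Lemma mean_ge0 A f eta : (forall s, 0 <= f s) -> 0 <= mu A f eta.
Proof. by move=> f0; rewrite sumr_ge0// => s _; rewrite mulr_ge0. Qed.

Lemma mean_gt0 A f eta s : (forall s, 0 <= f s) -> agree_outside A s eta -> 0 < f s ->
  0 < mu A f eta.
Proof.
move=> f0 sE fs; rewrite /mean (bigD1 s)//= ltr_wpDr ?mulr_gt0 ?gibbs_gt0//.
by rewrite sumr_ge0// => t _; rewrite mulr_ge0.
Qed.

Lemma mean_eq0 A f eta s : (forall s, 0 <= f s) -> mu A f eta = 0 ->
  agree_outside A s eta -> f s = 0.
Proof.
move=> f0 E sE; apply/eqP; rewrite eq_le f0 andbT leNgt; apply/negP => fs.
by have := mean_gt0 f0 sE fs; rewrite E ltxx.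
Qed.

Lemma mean_indep A f : independent_of A (mu A f).
Proof.
move=> s t st; rewrite !meanE /partition_function.
by congr (_ / _); apply: eq_bigl => u; exact: agree_outside_subr.
Qed.

Lemma mean_pull A f g eta : independent_of A g ->
  mu A (fun s => f s * g s) eta = mu A f eta * g eta.
Proof.
move=> gA; rewrite mulrC -meanZ; apply: eq_mean => s sE.
by rewrite (gA s eta)// mulrC.
Qed.

Lemma mean_id A f eta : independent_of A f -> mu A f eta = f eta.
Proof. by move=> fA; rewrite -[RHS](mean_cst A _ eta); apply: eq_mean => s /fA. Qed.

(** After exchanging the two sums, the configurations [s] that agree with [t] outside [B] contribute
    the total weight [partition_function B t], which cancels the inner normalization. *)
Lemma mean_tower A B f eta : B \subset A -> mu A (mu B f) eta = mu A f eta.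
Proof.
move=> BA; rewrite !meanE; congr (_ / _).
under eq_bigr => s _ do rewrite (meanE B) mulr_suml mulr_sumr.
rewrite (exchange_big_dep (fun t => agree_outside A t eta)) /=; last first.
  by move=> s t sE /(agree_outsideS BA) ts; apply: agree_outside_trans sE.
apply: eq_bigr => t tE.
transitivity (\sum_(s | agree_outside B s t) W s * (W t * f t / partition_function B t)).
  apply: eq_big => s.
    rewrite (agree_outside_sym B s t) andb_idl// => /(agree_outsideS BA) ts.
    by rewrite -(agree_outside_subl _ ts).
  move=> /andP[_ ts]; congr (_ * (_ / _)).
  by rewrite /partition_function; apply: eq_bigl => u; rewrite (agree_outside_subr _ ts).
by rewrite -mulr_suml -/(partition_function B t) mulrC divfK ?gt_eqF.
Qed.

(** The cross products bound the ratio of the normalized weights directly, so the normalizations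
    need no separate estimate; clear denominators and compare term by term. *)
Lemma weighted_mean_le (T : finType) (P : pred T) (w w' F : T -> R) (k : R) :
    (exists i, P i) -> (forall i, 0 < w i) -> (forall i, 0 < w' i) ->
    (forall i, 0 <= F i) ->
    (forall i j, P i -> P j -> w i * w' j <= k * (w' i * w j)) ->
  (\sum_(i | P i) w i * F i) / (\sum_(i | P i) w i) <=
  k * ((\sum_(i | P i) w' i * F i) / (\sum_(i | P i) w' i)).
Proof.
move=> [i0 Pi0] w0 w'0 F0 H.
have S0 (u : T -> R) : (forall i, 0 < u i) -> 0 < \sum_(i | P i) u i.
  by move=> u0; rewrite (bigD1 i0)//= ltr_wpDr// sumr_ge0// => i _; rewrite ltW.
rewrite ler_pdivrMr ?S0//; set X := \sum_(i | P i) w' i * F i.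
have -> (x y z : R) : k * (x / y) * z = k * (x * z) / y by rewrite !mulrA mulrAC.
rewrite ler_pdivlMr ?S0// !mulr_suml mulr_sumr; apply: ler_sum => i Pi.
rewrite mulrAC [w' i * _ * _]mulrAC [leRHS]mulrA ler_wpM2r// mulr_sumr mulr_sumr mulr_sumr.
by apply: ler_sum => j Pj; apply: H.
Qed.

(* Kernels with boundary conditions that differ on [B] are compared through the
   bijection that overwrites the spins in [B]. *)
Lemma mean_comparison A B f eta eta' (k : R) :
    [disjoint A & B] -> agree_outside B eta eta' -> independent_of B f ->
    (forall s, 0 <= f s) ->
    (forall s t, agree_outside B s t -> weight beta h A s <= k * weight beta h A t) ->
  mu A f eta <= k ^+ 2 * mu A f eta'.
Proof.
move=> AB ee fB f0 wk.
have k0 : 0 <= k.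
  by have := wk eta eta (agree_outside_refl _ _); rewrite -{1}[weight _ _ _ _]mul1r ler_pM2r// => /(le_trans ler01).
have nB x : x \in A -> x \notin B by move=> xA; rewrite (disjointFr AB xA).
have nA x : x \in B -> x \notin A by move=> xB; rewrite (disjointFl AB xB).
have reidx (F : Omega -> R) : \sum_(s | agree_outside A s eta') F s =
    \sum_(s | agree_outside A s eta) F (patch B eta' s).
  rewrite (reindex_onto (patch B eta') (patch B eta)) /=; last first.
    move=> s /agree_outsideP sE; apply: config_eqP => x; rewrite !patchE.
    by case: (boolP (x \in B)) => // xB; rewrite (sE x (nA x xB)).
  apply: eq_bigl => s; apply/andP/idP => [[/agree_outsideP H1 /eqP H2]|/agree_outsideP H].
    apply/agree_outsideP => x xA; rewrite -H2 !patchE; case: (boolP (x \in B)) => // xB.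
    by move: (H1 x xA); rewrite patchE (negPf xB) => ->; move/agree_outsideP: ee => ->; rewrite ?xB.
  split.
    apply/agree_outsideP => x xA; rewrite patchE; case: (boolP (x \in B)) => // xB.
    by rewrite (H x xA); move/agree_outsideP: ee => ->; rewrite ?xB.
  apply/eqP/config_eqP => x; rewrite !patchE; case: (boolP (x \in B)) => // xB.
  by rewrite (H x (nA x xB)).
have pB s : agree_outside B (patch B eta' s) s by exact: patch_agree.
rewrite !mean_weightE !reidx.
under [X in _ <= _ * (X / _)]eq_bigr => s _ do rewrite (fB _ _ (pB s)).
(* One factor [k] compares the numerators, the other the normalizations. *)
apply: weighted_mean_le => //; first by exists eta; exact: agree_outside_refl.
move=> s t _ _; have -> (x y : R) : k ^+ 2 * (x * y) = (k * x) * (k * y) by ring.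
by rewrite ler_pM ?wk// agree_outside_sym.
Qed.

(** * Separated sets and the Markov property *)

Definition separated A B :=
  forall x y, x \in A -> y \in B -> x != y /\ ~~ adjacent x y.

Lemma separated_sym A B : separated A B -> separated B A.
Proof.
move=> AB x y xB yA; have [nxy nadj] := AB _ _ yA xB.
by rewrite eq_sym; split=> //; rewrite /adjacent orbC.
Qed.

Lemma separated_disjoint A B : separated A B -> [disjoint A & B].
Proof.
move=> AB; apply/pred0P => x /=; apply/negP => /andP[xA xB].
by have [/eqP] := AB _ _ xA xB.
Qed.

Lemma separatedSl A A' B : A' \subset A -> separated A B -> separated A' B.
Proof. by move=> /fintype.subsetP AA AB x y /AA; apply: AB. Qed.

Lemma separatedSr A B B' : B' \subset B -> separated A B -> separated A B'.
Proof. by move=> /fintype.subsetP BB AB x y xA /BB; apply: AB. Qed.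

Lemma weight_separated A B s t : separated A B -> agree_outside B s t ->
  weight beta h A s = weight beta h A t.
Proof.
move=> AB /agree_outsideP st; rewrite /weight; congr (expR (_ * _)).
have stA x : x \in A :|: boundary A -> s x = t x.
  move=> xA; apply: st; apply/negP => xB; move: xA; rewrite !inE => /orP[xA|].
    by have [/eqP] := AB _ _ xA xB.
  case/andP => _ /exists_inP[y yA yx].
  by have [_] := AB _ _ yA xB; rewrite yx.
rewrite !energyE; congr (_ + _ * _).
  by apply: eq_bigr => p /and3P[/stA -> /stA ->].
by apply: eq_bigr => x xA; rewrite stA// inE xA.
Qed.

(** Spins in [B] do not enter the weight of [A], so [mean_comparison] applies with constant 1 in
    both directions. It requires nonnegative functions; a general [f] is first shifted by the sum of
    its absolute values. *)
Lemma mean_separated_indep A B f :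
  separated A B -> independent_of B f -> independent_of B (mu A f).
Proof.
move=> AB fB.
have ge0_le (g : Omega -> R) s t : (forall s, 0 <= g s) -> independent_of B g ->
    agree_outside B s t -> mu A g s <= mu A g t.
  move=> g0 gB st; rewrite -[leRHS]mul1r -(expr1n _ 2).
  apply: (mean_comparison (B := B)) => //; first exact: separated_disjoint.
  by move=> u v uv; rewrite mul1r (weight_separated AB uv).
have shift s t : agree_outside B s t -> mu A f s <= mu A f t.
  pose c := \sum_u `|f u|.
  have c0 u : 0 <= f u + c.
    rewrite /c (bigD1 u)//= addrA addr_ge0 ?sumr_ge0//.
    by rewrite -lerBlDl sub0r; have := ler_norm (- f u); rewrite normrN.
  move=> st; have := ge0_le (fun u => f u + c) s t c0 _ st.
  by rewrite !meanD !mean_cst lerD2r; apply=> u v uv; rewrite (fB u v).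
move=> s t st; apply/le_anti; rewrite !shift//.
by rewrite agree_outside_sym.
Qed.

(** By the tower property both sides have the same average over the union, and the iterated average
    is already independent of the spins in [A] and in [B]. *)
Lemma mean_setU A B f eta : separated A B -> mu (A :|: B) f eta = mu A (mu B f) eta.
Proof.
move=> AB.
rewrite -(mean_tower (B := B)) ?subsetUr// -(mean_tower (B := A)) ?subsetUl//.
apply: mean_id; apply: indepU; first exact: mean_indep.
by apply: mean_separated_indep => //; exact: mean_indep.
Qed.

Lemma mean_set0 f eta : mu set0 f eta = f eta.
Proof.
by apply: mean_id => s t /agree_outsideP st; congr f; apply: config_eqP => x; apply: st; rewrite inE.
Qed.

Lemma mean_setU_indep A B f eta : separated A B -> independent_of B f ->
  mu (A :|: B) f eta = mu A f eta.
Proof. by move=> AB fB; rewrite mean_setU//; apply: eq_mean => s _; rewrite mean_id. Qed.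

Lemma mean_comm A B f eta : separated A B -> mu A (mu B f) eta = mu B (mu A f) eta.
Proof.
move=> AB; rewrite -mean_setU// setUC mean_setU//; exact: separated_sym.
Qed.

(** * Entropy: variational bound, chain rule and convexity *)

Lemma EntE A f eta :
  ent A f eta = mu A (fun s => f s * (ln (f s) - ln (mu A f s))) eta.
Proof.
under [RHS]eq_mean => s _ do rewrite mulrBr.
rewrite meanB (@mean_pull A f (fun s => ln (mu A f s)))// => s t st.
by rewrite (mean_indep f st).
Qed.

Lemma eq_Ent A f g eta :
  (forall s, agree_outside A s eta -> f s = g s) -> ent A f eta = ent A g eta.
Proof.
move=> fg; rewrite /Ent (eq_mean fg); congr (_ - _).
by apply: eq_mean => s /fg ->.
Qed.

Lemma Ent_indep A f : independent_of A (ent A f).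
Proof. by move=> s t st; rewrite /Ent !(mean_indep _ st). Qed.

Lemma Ent_cst A f eta : independent_of A f -> ent A f eta = 0.
Proof.
move=> fA; rewrite /Ent (mean_id eta fA) mean_id ?subrr// => s t st.
by rewrite (fA s t).
Qed.

(** With [N] the mean of [f], the right side exceeds the left by [N (ln N - ln v) - N + v], which is
    nonnegative. *)
Lemma Ent_le_relative A f eta v : (forall s, 0 <= f s) -> 0 < v ->
  ent A f eta <= mu A (fun s => f s * (ln (f s) - ln v) - f s + v) eta.
Proof.
move=> f0 v0; have := sub_le_mulr_subln (mean_ge0 A eta f0) v0.
rewrite meanD meanB mean_cst.
under [X in _ -> _ <= X - _ + _]eq_mean => s _ do rewrite mulrBr mulrC.
rewrite meanB; under [X in _ -> _ <= _ - X - _ + _]eq_mean => s _ do rewrite mulrC.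
rewrite meanZ /Ent.
under [X in _ -> _ <= X - _ - _ + _]eq_mean => s _ do rewrite mulrC.
lra.
Qed.

(** Average [sqr_subsqrt_le] with [v] the mean of [f]: the linear terms cancel. If the mean is 0,
    then [f] vanishes on the support. *)
Lemma Ent_hellinger A f eta : (forall s, 0 <= f s) ->
  mu A (fun s => (Num.sqrt (f s) - Num.sqrt (mu A f eta)) ^+ 2) eta <= ent A f eta.
Proof.
move=> f0; have [N0|N0] := eqVneq (mu A f eta) 0.
  have fE s : agree_outside A s eta -> f s = 0 by exact: mean_eq0.
  rewrite (@eq_mean _ _ (fun=> 0)) => [|s /fE ->]; last by rewrite N0 subrr expr0n.
  rewrite mean_cst (@eq_Ent _ _ (fun=> 0)) ?Ent_cst// => s /fE ->//.
have {}N0 : 0 < mu A f eta by rewrite lt_neqAle eq_sym N0 mean_ge0.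
set N := mu A f eta in N0 *.
apply: (@le_trans _ _ (mu A (fun s => f s * (ln (f s) - ln N) - f s + N) eta)).
  by apply: ler_mean => s _; apply: sqr_subsqrt_le.
rewrite meanD meanB mean_cst EntE -/N subrK.
by apply: ler_mean => s sE; rewrite (mean_indep f sE).
Qed.

Lemma Ent_ge0 A f eta : (forall s, 0 <= f s) -> 0 <= ent A f eta.
Proof.
move=> f0; apply: le_trans (Ent_hellinger A eta f0).
by apply: mean_ge0 => s; exact: sqr_ge0.
Qed.

Lemma Ent_chain A B f eta : B \subset A ->
  ent A f eta = mu A (ent B f) eta + ent A (mu B f) eta.
Proof.
move=> BA; rewrite [in RHS]/Ent meanB !mean_tower//.
by rewrite addrA subrK.
Qed.

Lemma Ent_setU_indep A B f eta : separated A B -> independent_of B f ->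
  ent (A :|: B) f eta = ent A f eta.
Proof.
move=> AB fB; rewrite /Ent !mean_setU_indep// => s t st.
by rewrite (fB s t).
Qed.

(** Averaging over sites that do not interact with [A] can only decrease the entropy, since $(f,h)
    \mapsto f \ln(f/h)$ is jointly convex; the two averages are then exchanged by [mean_comm]. *)
Lemma Ent_jensen A B f eta : separated A B -> (forall s, 0 <= f s) ->
  ent A (mu B f) eta <= mu B (ent A f) eta.
Proof.
move=> AB f0.
have muf0 C s : 0 <= mu C f s by exact: mean_ge0.
pose G := mu B f; pose H := mu A f; pose K := mu (A :|: B) f.
have KA s : mu A G s = K s by rewrite /K mean_setU.
have KB s : mu B H s = K s by rewrite /K mean_setU// mean_comm.
(* Joint convexity through the tangent plane at [(G, K)]: pointwise, $f\ln(f/H) \ge (\ln(G/K)+1) f -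
   (G/K) H$, and the average of the right side over [B] is $G\ln(G/K)$. *)
have main s : G s * (ln (G s) - ln (K s)) <= mu B (fun t => f t * (ln (f t) - ln (H t))) s.
  have [G0|G0] := eqVneq (G s) 0.
    rewrite G0 mul0r (@eq_mean _ _ (fun=> 0)) ?mean_cst// => t ts.
    by rewrite (mean_eq0 f0 G0 ts) mul0r.
  have {}G0 : 0 < G s by rewrite lt_neqAle eq_sym G0 muf0.
  have K0 : 0 < K s.
    by rewrite -KA; apply: (@mean_gt0 _ _ _ s) => //; [exact: muf0|exact: agree_outside_refl].
  have -> : G s * (ln (G s) - ln (K s)) =
      mu B (fun t => (ln (G s) - ln (K s) + 1) * f t - (G s / K s) * H t) s.
    by rewrite meanB !meanZ KB -/(G s) divfK ?gt_eqF//; ring.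
  apply: ler_mean => t ts.
  have [H0|H0] := eqVneq (H t) 0.
    by rewrite (mean_eq0 f0 H0 (agree_outside_refl _ _)) H0; lra.
  have {}H0 : 0 < H t by rewrite lt_neqAle eq_sym H0 muf0.
  have := sub_le_mulr_subln (f0 t) (mulr_gt0 (divr_gt0 G0 K0) H0).
  rewrite lnM ?posrE ?divr_gt0// ln_div//; lra.
rewrite EntE.
apply: (@le_trans _ _ (mu A (mu B (fun t => f t * (ln (f t) - ln (H t)))) eta)).
  by apply: ler_mean => s _; rewrite -/(G s) [mu A (mu B f) s]KA.
by rewrite mean_comm//; apply: ler_mean => s _; rewrite EntE.
Qed.

(** * Tensorization and superadditivity over separated families *)

Section Families.
Variables (I : finType) (F : I -> {set V}).

Definition separated_family (l : seq I) :=
  forall i j, i \in l -> j \in l -> i != j -> separated (F i) (F j).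

Lemma separated_family_cons i l : i \notin l -> separated_family (i :: l) ->
  separated (F i) (\bigcup_(j <- l) F j) /\ separated_family l.
Proof.
move=> il H; split=> [x y xi|j k jl kl]; last by apply: H; rewrite inE ?jl ?kl orbT.
rewrite bigcup_seq => /bigcupP[j /= jl yj].
have ij : i != j by apply: contra il => /eqP ->.
by apply: (H i j) => //; rewrite inE ?eqxx// jl orbT.
Qed.

(** The chain rule splits off [F i]. What remains is the entropy over the other sets of the average
    over [F i], and [Ent_jensen] takes that average outside. *)
Lemma Ent_tensorization l f eta : uniq l -> separated_family l ->
    (forall s, 0 <= f s) ->
  ent (\bigcup_(i <- l) F i) f eta <= \sum_(i <- l) mu (\bigcup_(i <- l) F i) (ent (F i) f) eta.
Proof.
elim: l f eta => [|i l IH] f eta.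
  by move=> _ _ _; rewrite !big_nil /Ent !mean_set0 subrr.
move=> /= /andP[il ul] H f0; have [sep Hl] := separated_family_cons il H.
rewrite !big_cons; set U := \bigcup_(j <- l) F j in sep *.
rewrite (@Ent_chain _ (F i)) ?subsetUl// lerD2l.
rewrite setUC Ent_setU_indep; [|exact: separated_sym|exact: mean_indep].
apply: le_trans (Ent_jensen _ (separated_sym sep) f0) _.
rewrite -mean_sum setUC mean_setU//; apply: ler_mean => s _.
rewrite mean_sum; exact: IH.
Qed.

(** The same chain rule with Jensen used on the other term: the averaged entropy over [F i]
    dominates the entropy of the average over the other sets. Induction is applied to the average of
    [f] over [F i]. *)
Lemma Ent_superadditivity l f eta : uniq l -> separated_family l ->
    (forall s, 0 <= f s) ->
  \sum_(i <- l) ent (F i) (mu ((\bigcup_(i <- l) F i) :\: F i) f) eta <=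
  ent (\bigcup_(i <- l) F i) f eta.
Proof.
elim: l f eta => [|i l IH] f eta.
  by move=> _ _ _; rewrite !big_nil /Ent !mean_set0 subrr.
move=> /= /andP[il ul] H f0; have [sep Hl] := separated_family_cons il H.
rewrite !big_cons; set U := \bigcup_(j <- l) F j in sep *.
have -> : (F i :|: U) :\: F i = U.
  apply/setP => x; rewrite !inE; case xi: (x \in F i) => //=.
  by apply/esym/negP => xU; have [/eqP] := sep _ _ xi xU.
rewrite (@Ent_chain (F i :|: U) (F i)) ?subsetUl// lerD//.
  rewrite setUC mean_setU; last exact: separated_sym.
  apply: le_trans (Ent_jensen _ sep f0) _; apply: ler_mean => s _.
  by rewrite mean_id//; exact: Ent_indep.
rewrite setUC Ent_setU_indep; [|exact: separated_sym|exact: mean_indep].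
apply: (le_trans _ (IH (mu (F i) f) eta ul Hl _)); last by move=> s; exact: mean_ge0.
rewrite le_eqVlt; apply/orP; left; apply/eqP; apply: eq_big_seq => j jl.
apply: eq_Ent => s _.
have ij : i != j by apply: contra il => /eqP ->.
have sij : separated (F i) (F j) by apply: H; rewrite ?inE ?eqxx ?jl ?orbT.
rewrite -mean_setU; last first.
  exact: separatedSl (subsetDl _ _) (separated_sym sep).
congr (mean _ _ _ _ _); apply/setP => x; rewrite !inE.
case xj : (x \in F j) => //=.
by apply/esym/negP => xi; have [/eqP] := sij _ _ xi xj.
Qed.

End Families.

End Gibbs.

(** * Levels of a subtree and the entropy decomposition along them *)

Section Levels.
Variables (R : realType) (b : nat) (beta h : R) (tau : tree b -> bool).
Variables (r : tree b) (m : nat).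

Local Notation V := (vertex b m).
Local Notation Omega := (config tau r m).
Local Notation mu := (mean beta h).
Local Notation ent := (Ent beta h).

Implicit Types (x y z u v : V) (A B D U : {set V}) (eta s t : Omega) (f g : Omega -> R).

Lemma child_size u v : child u v -> size v = (size u).+1.
Proof. by move=> /existsP[i /eqP ->]; rewrite size_rcons. Qed.

Lemma child_prefix u v : child u v -> prefix u v.
Proof. by move=> /existsP[i /eqP ->]; rewrite -cats1 prefix_prefix. Qed.

Lemma prefix_child x u v : child u v -> (size x <= size u)%N -> prefix x v -> prefix x u.
Proof.
move=> /existsP[i /eqP ->] xu; rewrite !prefixE -cats1 takel_cat//.
Qed.

Lemma prefix_size_eq y z u : prefix y u -> prefix z u -> size y = size z -> y = z.
Proof.
rewrite !prefixE => /eqP yu /eqP zu yz; apply/val_inj.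
by rewrite /= -yu yz zu.
Qed.

Lemma in_subtree_at x y : (y \in subtree_at x) = (size y <= m)%N && prefix x y.
Proof. by rewrite !inE. Qed.

(** The complement of [block x k] in the subtree at [x]; [k = 0] gives the whole subtree and [k = 1]
    the proper descendants. *)
Definition level_ge x k : {set V} := [set y in subtree_at x | (size x + k <= size y)%N].

Lemma in_level_ge x k y :
  (y \in level_ge x k) = (y \in subtree_at x) && (size x + k <= size y)%N.
Proof. exact: in_set. Qed.

(** A list without repetitions rather than a set, to match the inductions on lists for separated
    families. *)
Definition layer x k : seq V := [seq y : V <- enum (subtree_at x) | size y == (size x + k)%N].

Lemma mem_layer x k y : (y \in layer x k) = (y \in subtree_at x) && (size y == (size x + k)%N).
Proof. by rewrite mem_filter mem_enum andbC. Qed.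

Lemma layer_uniq x k : uniq (layer x k).
Proof. by rewrite filter_uniq// enum_uniq. Qed.

Lemma level_ge0 x : level_ge x 0 = subtree_at x.
Proof.
apply/setP => y; rewrite in_set addn0 andb_idr// in_subtree_at => /andP[_].
exact: size_prefix.
Qed.

Lemma in_subtree_below x y :
  (y \in subtree_below x) = (y \in subtree_at x) && (size x < size y)%N.
Proof.
rewrite !inE andbC; case: (boolP (size y <= m)%N) => //= _.
case: (boolP (prefix x y)) => //= xy.
rewrite ltn_neqAle size_prefix// andbT; congr (~~ _).
apply/eqP/eqP => [->//|/esym E].
by apply: (@prefix_size_eq _ _ y) => //; exact: prefix_refl.
Qed.

Lemma level_ge1 x : level_ge x 1 = subtree_below x.
Proof. by apply/setP => y; rewrite in_subtree_below in_set addn1. Qed.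

Lemma level_ge_sub x j k : (j <= k)%N -> level_ge x k \subset level_ge x j.
Proof.
move=> jk; apply/fintype.subsetP => y; rewrite !in_set => /andP[-> H] /=.
by apply: leq_trans H; rewrite leq_add2l.
Qed.

Lemma level_ge_out x k : (m < size x + k)%N -> level_ge x k = set0.
Proof.
move=> H; apply/setP => y; rewrite !inE; apply/negP => /andP[/andP[ym _] ky].
by have := leq_trans H (leq_trans ky ym); rewrite ltnn.
Qed.

Lemma block_sub x l : block x l \subset subtree_at x.
Proof. by apply/fintype.subsetP => y; rewrite in_set => /andP[]. Qed.

Lemma subtree_below_sub x : subtree_below x \subset subtree_at x.
Proof. exact: subsetDl. Qed.

Lemma subtree_at_refl x : x \in subtree -> x \in subtree_at x.
Proof. by rewrite in_subtree_at prefix_refl andbT inE. Qed.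

Lemma subtree_at_trans x y : y \in subtree_at x -> subtree_at y \subset subtree_at x.
Proof.
rewrite in_subtree_at => /andP[_ xy]; apply/fintype.subsetP => z.
by rewrite !in_subtree_at => /andP[-> yz]; exact: prefix_trans yz.
Qed.

Lemma level_ge_bigcup x k :
  level_ge x k = \bigcup_(y <- layer x k) subtree_at y.
Proof.
apply/setP => z; rewrite in_set bigcup_seq; apply/andP/bigcupP => [[zx kz]|[y]].
  have zm := size_bseq z.
  have yP : (size (take (size x + k) z) <= m.+1)%N by rewrite size_takel// (leq_trans kz).
  exists (Bseq yP).
    rewrite mem_layer in_subtree_at /= size_takel// eqxx andbT.
    move: zx; rewrite in_subtree_at => /andP[zm' xz].
    by rewrite (leq_trans kz zm') /= prefixE take_takel ?leq_addr// -prefixE.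
  move: zx; rewrite !in_subtree_at => /andP[-> _] /=.
  by rewrite prefixE size_takel// eqxx.
rewrite mem_layer => /andP[yx /eqP yk] zy; split.
  by have /fintype.subsetP := subtree_at_trans yx; apply.
by rewrite -yk; move: zy; rewrite in_subtree_at => /andP[_ /size_prefix].
Qed.

Lemma level_geS_bigcup x k :
  level_ge x k.+1 = \bigcup_(y <- layer x k) subtree_below y.
Proof.
apply/setP => z; apply/idP/idP => [zk|].
  have : z \in level_ge x k.
    by have /fintype.subsetP := @level_ge_sub x k k.+1 (leqnSn k); apply.
  rewrite level_ge_bigcup !bigcup_seq => /bigcupP[y yl zy]; apply/bigcupP.
  exists y => //; rewrite in_subtree_below zy /=.
  move: yl; rewrite mem_layer => /andP[_ /eqP ->].
  by move: zk; rewrite in_set addnS => /andP[].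
rewrite bigcup_seq => /bigcupP[y yl]; rewrite in_subtree_below => /andP[zy yz].
rewrite in_set addnS; move: yl; rewrite mem_layer => /andP[yx /eqP <-]; rewrite yz andbT.
by have /fintype.subsetP := subtree_at_trans yx; apply.
Qed.

(** An edge leaving the subtree at [y] leads to the parent of [y], excluded by [size y <= size v],
    or to the outer boundary, excluded by [size v <= m]. *)
Lemma separated_subtree_at y A :
    (forall v, v \in A -> [/\ (size v <= m)%N, v \notin subtree_at y & (size y <= size v)%N]) ->
  separated (subtree_at y) A.
Proof.
move=> HA u v uy /HA[vm vy yv]; split.
  by apply: contraNneq vy => <-.
apply/negP => /orP[uv|vu]; move/negP: vy; apply; move: uy; rewrite !in_subtree_at vm /=.
  by move=> /andP[_ yu]; apply: prefix_trans yu (child_prefix uv).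
by move=> /andP[_ yu]; apply: prefix_child yu.
Qed.

Lemma layer_separated x k : separated_family (fun y => subtree_at y) (layer x k).
Proof.
move=> y z; rewrite !mem_layer => /andP[_ /eqP yk] /andP[_ /eqP zk] yz.
apply: separated_subtree_at => v; rewrite !in_subtree_at => /andP[vm zv]; rewrite vm /=.
rewrite yk -zk size_prefix//; split=> //.
by apply: contra yz => yv; apply/eqP/(prefix_size_eq yv zv); rewrite yk zk.
Qed.

(** The block ends at distance [l - 1], so the layer at distance [l] lies between the two sets. This
    is why [l.+1] appears in the proof of the block inequality. *)
Lemma separated_block x l : separated (block x l) (level_ge x l.+1).
Proof.
move=> u v; rewrite !in_set => /andP[_ ul] /andP[_ vl]; rewrite addnS in vl.
have uv := ltn_trans ul vl; split; first by apply: contraTneq uv => ->; rewrite ltnn.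
apply/negP => /orP[] /child_size E; move: uv; rewrite E.
  by move=> _; move: vl; rewrite E ltnS leqNgt ul.
by rewrite ltnNge ltnW.
Qed.

(** Tensorize over the subtrees rooted in the layer. For each root [y], the average over the deeper
    levels splits into one below [y] and one over the remaining sites [E]; [Ent_jensen] moves the
    latter outside, where the outer average absorbs it. *)
Lemma Ent_layer x k f eta : (forall s, 0 <= f s) ->
  ent (level_ge x k) (mu (level_ge x k.+1) f) eta <=
  \sum_(y <- layer x k) mu (level_ge x k) (ent (subtree_at y) (mu (subtree_below y) f)) eta.
Proof.
move=> f0; have Uk := level_ge_bigcup x k.
apply: (@le_trans _ _ (\sum_(y <- layer x k)
    mu (level_ge x k) (ent (subtree_at y) (mu (level_ge x k.+1) f)) eta)).
  rewrite Uk; apply: Ent_tensorization; first exact: layer_uniq.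
    exact: layer_separated.
  by move=> s; apply: mean_ge0.
rewrite [leLHS]big_seq [leRHS]big_seq; apply: ler_sum => y yl.
pose E := level_ge x k.+1 :\: subtree_at y.
move: (yl); rewrite mem_layer => /andP[yx /eqP yk].
have ET : level_ge x k.+1 = E :|: subtree_below y.
  apply/setP => z; rewrite in_setU in_setD in_subtree_below.
  case zy : (z \in subtree_at y) => /=; last by rewrite orbF.
  rewrite in_set addnS yk.
  by have /fintype.subsetP/(_ z zy) -> := subtree_at_trans yx.
have sep : separated (subtree_at y) E.
  apply: separated_subtree_at => v /setDP[]; rewrite in_level_ge => /andP[vx kv] vy.
  move: vx; rewrite in_subtree_at => /andP[vm _].
  by rewrite vm vy yk; split=> //; apply: leq_trans kv; rewrite leq_add2l.
have EU : E \subset level_ge x k.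
  by apply: fintype.subset_trans (subsetDl _ _) (level_ge_sub _ (leqnSn k)).
rewrite -[leRHS](mean_tower _ _ _ _ EU); apply: ler_mean => s _.
apply: (le_trans _ (Ent_jensen _ _ _ sep _)); last by move=> t; exact: mean_ge0.
rewrite le_eqVlt; apply/orP; left; apply/eqP; apply: eq_Ent => t _.
rewrite ET mean_setU//; apply: separatedSr (subtree_below_sub y) (separated_sym sep).
Qed.

(** Induction on [k]: the chain rule peels off one level of the remaining entropy and [Ent_layer]
    distributes it over the sites of that level. *)
Lemma Ent_levels x j k f eta : (j <= k)%N -> (forall s, 0 <= f s) ->
  ent (level_ge x j) f eta <=
  \sum_(y in subtree_at x | (size x + j <= size y < size x + k)%N)
    mu (level_ge x j) (ent (subtree_at y) (mu (subtree_below y) f)) eta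
  + mu (level_ge x j) (ent (level_ge x k) f) eta.
Proof.
move=> jk f0; elim: k jk => [|k IH].
  rewrite leqn0 => /eqP ->; rewrite mean_id; last exact: Ent_indep.
  by rewrite lerDr sumr_ge0// => y _; apply: mean_ge0 => s; apply: Ent_ge0 => t; apply: mean_ge0.
rewrite leq_eqVlt => /predU1P[->|].
  rewrite mean_id; last exact: Ent_indep.
  by rewrite lerDr sumr_ge0// => y _; apply: mean_ge0 => s; apply: Ent_ge0 => t; apply: mean_ge0.
rewrite ltnS => jk; apply: le_trans (IH jk) _.
have kk := level_ge_sub x (leqnSn k); have kj := level_ge_sub x jk.
rewrite [X in _ + X <= _](_ : _ = mu (level_ge x j) (ent (level_ge x k.+1) f) eta +
   mu (level_ge x j) (ent (level_ge x k) (mu (level_ge x k.+1) f)) eta); last first.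
  rewrite -[X in _ = X + _](mean_tower _ _ _ _ kj) -meanD.
  by apply: eq_mean => s _; apply: Ent_chain.
rewrite [X in _ + X <= _]addrC addrA lerD2r.
rewrite [leRHS](bigID (fun y => size y < size x + k)%N) /=; apply: lerD.
  rewrite le_eqVlt; apply/orP; left; apply/eqP; apply: eq_bigl => y.
  rewrite addnS ltnS -!andbA; do 2 congr (_ && _).
  by case: ltnP => // H; rewrite ?andbF ?andbT// ltnW.
apply: (@le_trans _ _ (mu (level_ge x j) (fun s => \sum_(y <- layer x k)
    mu (level_ge x k) (ent (subtree_at y) (mu (subtree_below y) f)) s) eta)).
  by apply: ler_mean => s _; apply: Ent_layer.
pose F y := ent (subtree_at y) (mu (subtree_below y) f).
rewrite mean_sum (eq_bigr _ (fun y _ => mean_tower beta h (F y) eta kj)) {}/F.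
rewrite /layer big_filter big_enum_cond /=.
rewrite le_eqVlt; apply/orP; left; apply/eqP; apply: eq_bigl => y.
rewrite addnS ltnS -leqNgt -!andbA; congr (_ && _).
by rewrite eq_sym eqn_leq; case: (leqP (size x + k) (size y)) => H; rewrite ?andbF// (leq_trans _ H) ?leq_add2l//= andbT.
Qed.

End Levels.

(** * Entropy mixing implies the block entropy inequality *)

Section EntropyMixing.
Variables (R : realType) (b : nat) (beta h : R) (tau : tree b -> bool).
Variables (r : tree b) (m : nat).

Local Notation V := (vertex b m).
Local Notation Omega := (config tau r m).
Local Notation mu := (mean beta h).
Local Notation ent := (Ent beta h).

Implicit Types (x y z u v : V) (A B D U : {set V}) (eta s t : Omega) (f g : Omega -> R).

(** Variational formula for the entropy. With [F] and [K] the means of [f] and [phi], apply the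
    tangent inequality to [f] and [F phi / K]; its linear terms cancel on average. Where [phi]
    vanishes, the hypothesis on [f] makes the convention [ln 0 = 0] harmless. *)
Lemma mean_mulr_ln_le A f (phi : Omega -> R) eta :
    (forall s, 0 <= f s) -> (forall s, 0 <= phi s) -> (forall s, phi s = 0 -> f s = 0) ->
  mu A (fun s => f s * ln (phi s)) eta <=
  ent A f eta + mu A f eta * ln (mu A phi eta).
Proof.
move=> f0 phi0 fphi.
have [F0|F0] := eqVneq (mu A f eta) 0.
  have fE s : agree_outside A s eta -> f s = 0 by exact: (mean_eq0 f0 F0).
  rewrite F0 mul0r addr0 (@eq_mean _ _ _ _ _ _ _ _ _ (fun=> 0)) ?mean_cst ?Ent_ge0//.
  by move=> s /fE ->; rewrite mul0r.
have {}F0 : 0 < mu A f eta by rewrite lt_neqAle eq_sym F0 mean_ge0.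
set F := mu A f eta in F0 *; set K := mu A phi eta.
have K0 : 0 < K.
  rewrite lt_neqAle mean_ge0// andbT; apply/negP => /eqP/esym K0.
  suff : F = 0 by move=> E; rewrite E ltxx in F0.
  rewrite -(mean_cst beta h A 0 eta); apply: eq_mean => s sE.
  by apply: fphi; apply: mean_eq0 K0 sE.
have -> : ent A f eta + F * ln K = mu A (fun s => f s * (ln (f s) - ln (mu A f s))
    + (ln K - 1) * f s + F / K * phi s) eta.
  by rewrite !meanD !meanZ -EntE -/F -/K divfK ?gt_eqF//; ring.
apply: ler_mean => s sE; rewrite (mean_indep _ _ _ sE) -/F.
have [p0|p0] := eqVneq (phi s) 0; first by rewrite p0 fphi//; lra.
have {}p0 : 0 < phi s by rewrite lt_neqAle eq_sym p0 phi0.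
have := sub_le_mulr_subln (f0 s) (mulr_gt0 (divr_gt0 F0 K0) p0).
rewrite lnM ?posrE ?divr_gt0// ln_div//; lra.
Qed.

Lemma exists_spin x e eta : x \in subtree ->
  exists2 s : Omega, s x = e & agree_outside [set x] s eta.
Proof.
move=> xT; pose u := [ffun y => if y == x then e else eta y].
have uP : agrees_with_tau tau r u.
  apply/forall_inP => y yb; rewrite ffunE.
  case: (eqVneq y x) => [yx|_]; last by have /forall_inP/(_ y yb) := configP eta.
  by move: xT yb; rewrite yx !inE => xm /eqP E; rewrite E ltnn in xm.
exists (Config uP); first by rewrite /= ffunE eqxx.
by apply/agree_outsideP => y; rewrite finset.in_set1 /= ffunE => /negPf ->.
Qed.

(** Once the spins outside the subtree are fixed, such an [f] depends on the spin at [x] only; [u]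
    and [v] are its values at two configurations differing at most at [x]. *)
Lemma mean_two_point x f eta : x \in subtree -> independent_of (subtree_below x) f ->
  exists u v : R, [/\ (forall s, agree_outside (subtree_at x) s eta -> f s = if s x then u else v),
    mu (subtree_at x) f eta = prob beta h (subtree_at x) eta (fun s => s x == true) * u
      + prob beta h (subtree_at x) eta (fun s => s x == false) * v &
    (forall s, 0 <= f s) -> 0 <= u /\ 0 <= v].
Proof.
move=> xT fi.
have [s1 s1x s1E] := exists_spin true eta xT; have [s2 s2x s2E] := exists_spin false eta xT.
have sub1 : [set x] \subset subtree_at x by rewrite sub1set subtree_at_refl.
have fE s : agree_outside (subtree_at x) s eta -> f s = if s x then f s1 else f s2.
  have aux t : agree_outside [set x] t eta -> agree_outside (subtree_at x) s eta ->
      s x = t x -> f s = f t.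
    move=> tE sE st; apply: fi; apply/agree_outsideP => y.
    rewrite in_setD1 negb_and negbK => /orP[/eqP -> //|yx].
    move/agree_outsideP: sE => ->//; move/agree_outsideP: tE => ->//.
    by rewrite in_set1; apply: contra yx => /eqP ->; rewrite subtree_at_refl.
  by move=> sE; case sx : (s x); apply: aux => //; rewrite sx ?s1x ?s2x.
exists (f s1), (f s2); split=> //.
rewrite /mean (bigID (fun s : Omega => s x == true)) /= /prob !mulr_suml; congr (_ + _).
  apply: eq_bigr => s /eqP sx; rewrite gibbsE; case: ifP => [sE|]; last by rewrite !mul0r.
  by rewrite fE// sx.
apply: eq_big => [s|s]; first by case: (s x).
move=> /negPf sx; rewrite gibbsE; case: ifP => [sE|]; last by rewrite !mul0r.
by rewrite fE//; move: sx; case: (s x).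
Qed.

Lemma pmin_le_prob x e eta : x \in subtree ->
  pmin beta h tau r m <= prob beta h (subtree_at x) eta (fun s => s x == e).
Proof.
move=> xT; rewrite /pmin.
apply: (bigmin_inf x) => //; apply: (bigmin_inf e) => //.
exact: (bigmin_inf eta).
Qed.

Lemma prob_gt0 x e eta : x \in subtree ->
  0 < prob beta h (subtree_at x) eta (fun s => s x == e).
Proof.
move=> xT; have [s sx sE] := exists_spin e eta xT.
rewrite /prob (bigD1 s) ?sx//= ltr_wpDr//.
  by rewrite sumr_ge0// => t _; exact: gibbs_ge0.
apply/gibbs_gt0/(agree_outsideS _ sE).
by rewrite sub1set subtree_at_refl.
Qed.

Lemma pmin_gt0 : 0 < pmin beta h tau r m.
Proof.
rewrite /pmin; apply: lt_bigmin => [|x xT]; first exact: ltr01.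
apply: lt_bigmin => [|e _]; first exact: ltr01.
apply: lt_bigmin => [|eta _]; first exact: ltr01.
exact: prob_gt0.
Qed.

Lemma prob_sum x eta :
  prob beta h (subtree_at x) eta (fun s => s x == true) +
  prob beta h (subtree_at x) eta (fun s => s x == false) = 1.
Proof.
rewrite -(sum_gibbs beta h (subtree_at x) eta) [RHS](bigID (fun s : Omega => s x == true)) /=.
by congr (_ + _); apply: eq_bigl => s; case: (s x).
Qed.

Lemma entropy_mixing_root_le x l (e : R) g eta : x \in subtree -> 0 <= e ->
    entropy_mixing beta h tau r m l ((e * pmin beta h tau r m) ^+ 2) ->
    (forall s, 0 <= g s) ->
  ent (subtree_at x) (mu (subtree_below x) g) eta <=
  mu (subtree_at x) (ent (block x l) g) eta + e * ent (subtree_at x) g eta.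
Proof.
move=> xT e0 EM g0; set S := subtree_at x; set S' := subtree_below x; set B := block x l.
have BS : B \subset S := block_sub x l.
have S'S : S' \subset S := subtree_below_sub x.
(* The covariance to be controlled is that of [p1] and [p2]. Entropy mixing will be applied to [G],
   which does not depend on the spins of the block. *)
pose p1 := mu S' g; pose k := mu B p1; pose G := mu B g; pose p2 := mu S' G.
have p10 s : 0 <= p1 s by apply: mean_ge0.
have G0 s : 0 <= G s by apply: mean_ge0.
have p20 s : 0 <= p2 s by apply: mean_ge0.
have k0 s : 0 <= k s by apply: mean_ge0.
have entB0 s : 0 <= ent B g s by apply: Ent_ge0.
set N := mu S g eta.
have N1 : mu S p1 eta = N by apply: mean_tower.
have NG : mu S G eta = N by apply: mean_tower.
have N2 : mu S p2 eta = N by rewrite -NG; apply: mean_tower.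
have [N0|N0] := eqVneq N 0.
  rewrite (@eq_Ent _ _ _ _ _ _ _ _ _ (fun=> 0)).
    by rewrite Ent_cst// addr_ge0 ?mulr_ge0 ?mean_ge0 ?Ent_ge0.
  by move=> s sE; exact: (mean_eq0 p10 (etrans N1 N0) sE).
have {}N0 : 0 < N by rewrite lt_neqAle eq_sym N0 mean_ge0.
have p1g s : p1 s = 0 -> g s = 0.
  by move=> E; apply: (mean_eq0 g0 E); exact: agree_outside_refl.
(* [ln p1] does not depend on the spins below [x], so it may be integrated against [g] instead of
   [p1]; the variational formula is then applied inside the block. *)
have step1 : ent S p1 eta <= mu S (ent B g) eta + mu S (fun s => G s * ln (k s)) eta - N * ln N.
  rewrite {1}/Ent N1 lerB// -meanD.
  have -> : mu S (fun s => p1 s * ln (p1 s)) eta = mu S (fun s => g s * ln (p1 s)) eta.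
    rewrite -[RHS](mean_tower _ _ _ _ S'S); apply: eq_mean => s _.
    by rewrite (@mean_pull _ _ _ _ _ _ _ _ g (fun t => ln (p1 t)))// => t u tu; rewrite /p1 (mean_indep _ _ _ tu).
  rewrite -[leLHS](mean_tower _ _ _ _ BS); apply: ler_mean => s _.
  exact: mean_mulr_ln_le.
(* Linearize the logarithm: [ln (k / N) <= k / N - 1]. *)
have step2 : mu S (fun s => G s * ln (k s)) eta - N * ln N <=
    N^-1 * mu S (fun s => G s * k s) eta - N.
  have -> : N * ln N = mu S (fun s => ln N * G s) eta by rewrite meanZ NG mulrC.
  rewrite -meanB -meanZ -[X in _ <= _ - X]NG -meanB; apply: ler_mean => s _.
  have [ks|ks] := eqVneq (k s) 0.
    suff -> : G s = 0 by lra.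
    rewrite -(mean_cst beta h B 0 s); apply: eq_mean => t ts.
    by apply: p1g; apply: (mean_eq0 p10 ks).
  have {}ks : 0 < k s by rewrite lt_neqAle eq_sym ks k0.
  have := le_ln1Dx (x := k s / N - 1).
  have -> : 1 + (k s / N - 1) = k s / N by ring.
  rewrite ltrBDl subrr divr_gt0// ln_div// => /(_ isT).
  have -> : N^-1 * (G s * k s) - G s = G s * (k s / N - 1) by ring.
  have -> : G s * ln (k s) - ln N * G s = G s * (ln (k s) - ln N) by ring.
  by move=> H; apply: ler_wpM2l.
(* Both sides equal the mean of [p1 * G]: averaging over the block turns [p1] into [k], averaging
   below [x] turns [G] into [p2]. *)
have GkE : mu S (fun s => G s * k s) eta = mu S (fun s => p2 s * p1 s) eta.
  transitivity (mu S (fun s => p1 s * G s) eta).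
    rewrite -[RHS](mean_tower _ _ _ _ BS); apply: eq_mean => s _.
    by rewrite mean_pull; [rewrite mulrC|exact: mean_indep].
  rewrite -[LHS](mean_tower _ _ _ _ S'S); apply: eq_mean => s _.
  under eq_mean do rewrite mulrC.
  by rewrite mean_pull; [|exact: mean_indep].
have [a1 [b1 [p1E M1 ab1]]] := mean_two_point eta xT (mean_indep beta h (A := S') g).
have [a2 [b2 [p2E M2 ab2]]] := mean_two_point eta xT (mean_indep beta h (A := S') G).
have val (q : Omega -> R) (u v : R) :
    (forall s, agree_outside S s eta -> q s = if s x then u else v) ->
    mu S q eta = prob beta h S eta (fun s => s x == true) * u
      + prob beta h S eta (fun s => s x == false) * v.
  move=> H.
  rewrite (@eq_mean _ _ _ _ _ _ _ _ _ (fun s : Omega => if s x then u else v))//.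
  have [|u' [v' [E -> _]]] := @mean_two_point x (fun s : Omega => if s x then u else v) eta xT.
    by move=> s t /agree_outsideP -> //; rewrite in_setD1 eqxx.
  have [s1 s1x s1E] := exists_spin true eta xT; have [s2 s2x s2E] := exists_spin false eta xT.
  have sub1 : [set x] \subset S by rewrite sub1set subtree_at_refl.
  have := E s1 (agree_outsideS sub1 s1E); rewrite s1x => <-.
  by have := E s2 (agree_outsideS sub1 s2E); rewrite s2x => <-.
set P := prob beta h S eta (fun s => s x == true) in M1 M2 val.
set Q := prob beta h S eta (fun s => s x == false) in M1 M2 val.
have P0 : 0 < P by apply: prob_gt0.
have Q0 : 0 < Q by apply: prob_gt0.
have PQ : P + Q = 1 by apply: prob_sum.
have pP : pmin beta h tau r m <= P by apply: pmin_le_prob.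
have pQ : pmin beta h tau r m <= Q by apply: pmin_le_prob.
have [a10 b10] := ab1 p10; have [a20 b20] := ab2 p20.
have E1 : ent S p1 eta = P * (a1 * ln a1) + Q * (b1 * ln b1) - N * ln N.
  rewrite /Ent N1 (val _ (a1 * ln a1) (b1 * ln b1))//.
  by move=> s /p1E; rewrite -/(p1 s) => ->; case: (s x).
have E2 : ent S p2 eta = P * (a2 * ln a2) + Q * (b2 * ln b2) - N * ln N.
  rewrite /Ent N2 (val _ (a2 * ln a2) (b2 * ln b2))//.
  by move=> s /p2E; rewrite -/(p2 s) => ->; case: (s x).
have E12 : mu S (fun s => p2 s * p1 s) eta = P * (a2 * a1) + Q * (b2 * b1).
  apply: val => // s sE; move: (p1E s sE) (p2E s sE); rewrite -/(p1 s) -/(p2 s) => -> ->.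
  by case: (s x).
move: pP pQ (pmin_gt0) EM; set pm := pmin beta h tau r m => pP pQ pm0 EM.
have V1 := two_point_variance_le_entropy P0 Q0 PQ pP pQ a10 b10.
have V2 := two_point_variance_le_entropy P0 Q0 PQ pP pQ a20 b20.
rewrite -M1 -/p1 N1 -E1 in V1; rewrite -M2 -/p2 N2 -E2 in V2.
have entG : ent S G eta <= ent S g eta.
  by rewrite (Ent_chain _ _ g eta BS) lerDr mean_ge0.
have Ep1 : ent S p1 eta <= ent S g eta.
  by rewrite (Ent_chain _ _ g eta S'S) lerDr; apply: mean_ge0 => s; exact: Ent_ge0.
have Ep2 : ent S p2 eta <= (e * pm) ^+ 2 * ent S g eta.
  apply: (le_trans (EM x eta G xT G0 (mean_indep beta h (A := B) g))).
  by apply: ler_wpM2l; [exact: sqr_ge0|exact: entG].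
suff cov : N^-1 * mu S (fun s => p2 s * p1 s) eta - N <= e * ent S g eta.
  by apply: le_trans step1 _; rewrite -addrA lerD2l (le_trans step2)// GkE.
rewrite -(ler_pM2l N0) mulrBr mulrA divff ?gt_eqF// mul1r E12.
rewrite -(ler_pM2l pm0).
set E := ent S g eta in entG Ep1 Ep2 *.
have E0 : 0 <= E by apply: Ent_ge0.
set c1 := a1 - b1; set c2 := a2 - b2.
have -> : P * (a2 * a1) + Q * (b2 * b1) - N * N = P * Q * (c1 * c2).
  have covE (p q u1 v1 u2 v2 : R) : p + q = 1 ->
      p * (u2 * u1) + q * (v2 * v1) - (p * u1 + q * v1) * (p * u2 + q * v2)
      = p * q * ((u1 - v1) * (u2 - v2)).
    move=> pq; have -> : q = 1 - p by rewrite -pq addrAC subrr add0r.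
    by ring.
  by rewrite -(covE _ _ _ _ _ _ PQ) -M1 -M2 N1 N2.
(* For a two-valued spin the squared covariance is exactly the product of the variances. [V1] and
   [V2] bound these by entropies at the cost of [pm] each, and the [pm ^+ 2] in the mixing constant
   compensates this. *)
apply: le_trans (ler_norm _) _; rewrite -(@ler_pXn2r _ 2) ?nnegrE//; last first.
  by rewrite !mulr_ge0 ?(ltW pm0) ?(ltW N0).
rewrite real_normK ?num_real//.
have -> : (pm * (P * Q * (c1 * c2))) ^+ 2 =
    (pm * (P * Q * c1 ^+ 2)) * (pm * (P * Q * c2 ^+ 2)) by ring.
have -> : (pm * (N * (e * E))) ^+ 2 = (N * E) * (N * ((e * pm) ^+ 2 * E)) by ring.
have cc0 c : 0 <= pm * (P * Q * c ^+ 2).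
  apply: mulr_ge0; first exact: ltW.
  by apply: mulr_ge0; [rewrite mulr_ge0 ?ltW|exact: sqr_ge0].
apply: ler_pM => //.
- by apply: le_trans V1 _; rewrite ler_pM2l.
- by apply: le_trans V2 _; rewrite ler_pM2l.
Qed.

(** Exchange the sums: a site has at most one ancestor at each distance below [k], so it is counted
    at most [k] times. *)
Lemma sum_ancestors_le (F : V -> R) k : (forall y, 0 <= F y) ->
  \sum_(x in @subtree b m) \sum_(y in subtree_at x | (size y < size x + k)%N) F y
  <= k%:R * \sum_(y in @subtree b m) F y.
Proof.
move=> F0.
have sub x y : y \in subtree_at x -> y \in @subtree b m by rewrite in_subtree_at inE => /andP[].
rewrite (exchange_big_dep (mem (@subtree b m))) /=; last by move=> x y _ /andP[/sub].
rewrite mulr_sumr; apply: ler_sum => y yT.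
rewrite sumr_const -[leLHS]mulr_natl ler_wpM2r// ler_nat.
set P := (X in #|X|); rewrite -(size_iota 0 k) cardE.
pose d := fun x : V => (size y - size x)%N.
rewrite -(size_map d); apply: uniq_leq_size.
  rewrite map_inj_in_uniq ?enum_uniq// => x1 x2; rewrite !mem_enum.
  move=> /andP[_ /andP[+ _]] /andP[_ /andP[+ _]].
  rewrite !in_subtree_at => /andP[_ p1] /andP[_ p2] dE.
  apply: (prefix_size_eq p1 p2).
  by rewrite -(subKn (size_prefix p1)) -(subKn (size_prefix p2)) -/(d x1) -/(d x2) dE.
move=> n /mapP[x]; rewrite mem_enum => /andP[_ /andP[yx xk]] ->.
move: yx; rewrite in_subtree_at => /andP[_ /size_prefix xy].
by rewrite mem_iota /= add0n /d -(ltn_add2l (size x)) subnKC.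
Qed.

Lemma Ent_T_le_block_entropy l (delta : R) : (1 <= l)%N -> 0 < delta <= 1 ->
    entropy_mixing beta h tau r m l
      (((1 - delta) * pmin beta h tau r m / (l%:R + 1 - delta)) ^+ 2) ->
  forall f, (forall s, 0 <= f s) ->
  Ent_T beta h f <= 2 / delta * block_entropy beta h l f.
Proof.
move=> l1 /andP[d0 d1] EM f f0.
have l1' : 1 <= l%:R :> R by rewrite ler1n.
have ld0 : 0 < l%:R + 1 - delta by lra.
pose e := (1 - delta) / (l%:R + 1 - delta).
have e0 : 0 <= e by rewrite divr_ge0 ?(ltW ld0)// subr_ge0.
have {}EM : entropy_mixing beta h tau r m l ((e * pmin beta h tau r m) ^+ 2).
  by rewrite /e mulrAC.
pose root := restriction tau r m.
pose F y := ent (subtree_at y) (mu (subtree_below y) f).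
pose a y := mu subtree (F y) root.
have F0 y s : 0 <= F y s by apply: Ent_ge0 => t; apply: mean_ge0.
have a0 y : 0 <= a y by apply: mean_ge0.
have subT x : subtree_at x \subset @subtree b m by apply/fintype.subsetP => y; rewrite in_subtree_at inE => /andP[].
have muT A g x : A \subset subtree_at x -> mu subtree (mu A g) root = mu subtree g root.
  by move=> Ax; apply: mean_tower; apply: fintype.subset_trans (subT x).
(* The root estimate is applied to [g], the average of [f] over distances greater than [l]. This
   keeps the error within distance [l] of [x], and [Ent_jensen] returns the block entropy of [g] to
   that of [f]. *)
have local x : x \in subtree -> a x <= mu subtree (ent (block x l) f) root
    + e * \sum_(y in subtree_at x | (size y < size x + l.+1)%N) a y.
  move=> xT; pose D := level_ge x l.+1; pose g := mu D f.
  have g0 s : 0 <= g s by apply: mean_ge0.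
  have DS' : D \subset subtree_below x by rewrite -level_ge1 level_ge_sub.
  have S'S := subtree_below_sub x.
  have gE s : mu (subtree_below x) g s = mu (subtree_below x) f s by apply: mean_tower.
  have entg s : ent (subtree_at x) g s <=
      mu (subtree_at x) (fun s => \sum_(y in subtree_at x | (size y < size x + l.+1)%N) F y s) s.
    rewrite (Ent_chain _ _ g s S'S) (eq_Ent _ _ (fun t _ => gE t)) -/(F x s).
    rewrite -[F x s](mean_id beta h s (@Ent_indep _ _ beta h _ _ _ (subtree_at x) (mu (subtree_below x) f))).
    rewrite -(mean_tower _ _ (ent (subtree_below x) g) _ S'S).
    pose F' t := \sum_(y in subtree_at x | (size x + 1 <= size y < size x + l.+1)%N) F y t.
    (* Decompose the entropy of [f] below [x] by levels and by the chain rule over [D]; the averaged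
       entropy over [D] occurs on both sides and cancels. *)
    have S'F t : ent (subtree_below x) g t <= mu (subtree_below x) F' t.
      have := Ent_levels beta h x t (ltn0Sn l) f0; rewrite !level_ge1.
      by rewrite (Ent_chain _ _ f t DS') -/D -/g addrC lerD2r mean_sum.
    have -> : mu (subtree_at x) (fun s => \sum_(y in subtree_at x | (size y < size x + l.+1)%N) F y s) s
        = mu (subtree_at x) F' s + mu (subtree_at x) (F x) s.
      rewrite -meanD; apply: eq_mean => t _.
      rewrite (bigD1 x) /=; last by rewrite subtree_at_refl//= -[X in (X < _)%N]addn0 ltn_add2l.
      rewrite addrC; congr (_ + _); apply: eq_bigl => y.
      rewrite addn1 -andbA; case yx : (y \in subtree_at x) => //=.
      have := in_subtree_below x y; rewrite in_setD1 yx andbT /= => ->.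
      by rewrite andbC.
    rewrite lerD//.
    rewrite -[leRHS](mean_tower _ _ _ _ S'S); apply: ler_mean => t _.
    by rewrite mean_id//; exact: Ent_indep.
  have key s : F x s <= mu (subtree_at x) (ent (block x l) f) s + e *
      mu (subtree_at x) (fun s => \sum_(y in subtree_at x | (size y < size x + l.+1)%N) F y s) s.
    rewrite /F -(eq_Ent _ _ (fun t _ => gE t)).
    apply: le_trans (entropy_mixing_root_le s xT e0 EM g0) _.
    apply: lerD; last by rewrite ler_wpM2l.
    apply: (@le_trans _ _ (mu (subtree_at x) (mu D (ent (block x l) f)) s)).
      by apply: ler_mean => t _; apply: Ent_jensen => //; exact: separated_block.
    by rewrite mean_tower// -level_ge0 level_ge_sub.
  apply: (le_trans (ler_mean _ _ (fun s _ => key s))).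
  have Txx : subtree_at x \subset subtree_at x by [].
  rewrite meanD meanZ !(muT _ _ _ Txx).
  by rewrite mean_sum.
have entT : Ent_T beta h f <= \sum_(y in subtree) a y.
  have nilP : (size (@nil 'I_b) <= m.+1)%N by [].
  pose o : V := Bseq nilP.
  have TE : subtree_at o = subtree.
    by apply/setP => y; rewrite in_subtree_at inE /o /= prefix0s andbT.
  have := Ent_levels beta h o root (leq0n m.+1) f0.
  rewrite (@level_ge_out _ _ o m.+1)// level_ge0 TE.
  have ent0 s : ent set0 f s = 0 by rewrite /Ent !mean_set0 subrr.
  rewrite (eq_mean _ _ (fun s _ => ent0 s)) mean_cst addr0 => /le_trans; apply.
  rewrite le_eqVlt; apply/orP; left; apply/eqP; apply: eq_bigl => y.
  by rewrite !add0n /= ltnS inE andbb.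
have sumE : \sum_(x in subtree) a x <= block_entropy beta h l f
    + e * (l%:R + 1) * \sum_(y in subtree) a y.
  apply: le_trans (ler_sum _ local) _; rewrite big_split /= -mulr_sumr lerD2l.
  by rewrite -mulrA ler_wpM2l// natr1 sum_ancestors_le.
apply: le_trans entT _; set Sa := \sum_(y in subtree) a y in sumE *.
set E := block_entropy _ _ _ _ in sumE *.
have Sa0 : 0 <= Sa by apply: sumr_ge0.
(* The choice of [e] gives $1 - e(l+1) = \delta l/(l+1-\delta)$, which is at least $\delta/2$
   because $l \ge 1$. This is the source of the constant [2 / delta]. *)
have c : delta / 2 <= 1 - e * (l%:R + 1).
  have -> : 1 - e * (l%:R + 1) = delta * (l%:R / (l%:R + 1 - delta)).
    by rewrite /e; field; rewrite gt_eqF.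
  by rewrite ler_pM2l// ler_pdivlMr//; lra.
have : delta / 2 * Sa <= E by apply: le_trans (ler_wpM2r Sa0 c) _; lra.
by rewrite mulrC -ler_pdivlMr ?divr_gt0// invf_div mulrC.
Qed.

End EntropyMixing.

(** * Logarithmic Sobolev inequality for sets of bounded size *)

Section BlockSobolev.
Variables (R : realType) (b : nat) (beta h : R) (tau : tree b -> bool).
Variables (r : tree b) (m : nat).

Local Notation V := (vertex b m).
Local Notation Omega := (config tau r m).
Local Notation mu := (mean beta h).
Local Notation ent := (Ent beta h).

Implicit Types (x y z u v : V) (A B D U : {set V}) (eta s t : Omega) (f g : Omega -> R).

(** Lower bound for the probability of any admissible configuration on at most [n] sites: there are
    at most [2 ^ n] of them, and changing all the spins costs at most [n] site bounds. *)
Definition gibbs_bound n : R := (2 ^+ n * expR (beta * (n%:R * site_bound b h)))^-1.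

Lemma gibbs_bound_gt0 n : 0 < gibbs_bound n.
Proof. by rewrite invr_gt0 mulr_gt0 ?exprn_gt0 ?expR_gt0. Qed.

Lemma card_agree_outside A eta : (#|[set s : Omega | agree_outside A s eta]| <= 2 ^ #|A|)%N.
Proof.
rewrite -card_powerset.
rewrite -(card_in_imset (f := fun s : Omega => [set y in A | s y])).
  apply/subset_leq_card/fintype.subsetP => B /imsetP[s _ ->].
  by rewrite powersetE; apply/fintype.subsetP => y; rewrite in_set => /andP[].
move=> s t; rewrite !in_set => /agree_outsideP sE /agree_outsideP tE st.
apply: config_eqP => y; have [yA|yA] := boolP (y \in A); last by rewrite sE ?tE.
by move/setP/(_ y): st; rewrite !in_set yA.
Qed.

Lemma gibbs_ge A eta s n : 0 <= beta -> (#|A| <= n)%N -> agree_outside A s eta ->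
  gibbs_bound n <= gibbs beta h A eta s.
Proof.
move=> b0 An sE; rewrite gibbsE sE.
have sb0 := site_bound_ge0 b h.
have wle t : agree_outside A t eta ->
    weight beta h setT t <= expR (beta * (n%:R * site_bound b h)) * weight beta h setT s.
  move=> tE; rewrite /weight -expRD ler_expR -mulrDr ler_wpM2l// -lerBlDr.
  apply: (@le_trans _ _ (#|A|%:R * site_bound b h)); last by rewrite ler_wpM2r// ler_nat.
  apply: lipschitz_chain; last by rewrite (agree_outside_subr _ sE).
  by move=> y u v _ _; exact: energy_lipschitz.
rewrite ler_pdivlMr ?partition_function_gt0// /gibbs_bound.
rewrite -ler_pdivlMl ?invr_gt0 ?mulr_gt0 ?exprn_gt0 ?expR_gt0// invrK.
apply: le_trans (ler_sum _ wle) _.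
rewrite sumr_const -[leLHS]mulr_natl -mulrA.
apply: ler_wpM2r; first by rewrite mulr_ge0 ?expR_ge0 ?weight_ge0.
rewrite -natrX ler_nat; apply: (@leq_trans (2 ^ #|A|)); last by rewrite leq_pexp2l.
by apply: leq_trans (card_agree_outside A eta); rewrite cardsE.
Qed.

Lemma VarE A f eta : Var beta h A f eta = mu A (fun s => (f s - mu A f eta) ^+ 2) eta.
Proof.
rewrite /Var; have -> : mu A (fun s => (f s - mu A f eta) ^+ 2) eta =
    mu A (fun s => f s ^+ 2 + (- (2 * mu A f eta)) * f s + mu A f eta ^+ 2) eta.
  by apply: eq_mean => s _; ring.
by rewrite !meanD meanZ mean_cst; ring.
Qed.

Lemma Var_ge0 A f eta : 0 <= Var beta h A f eta.
Proof. by rewrite VarE mean_ge0// => s; exact: sqr_ge0. Qed.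

(** Keep only the two terms of the variance at [s] and [t], each of mass at least [q], and use
    $(a-b)^2 \le 2(a-c)^2 + 2(b-c)^2$ with [c] the mean. *)
Lemma sqr_sub_le_Var A f s t (q : R) : 0 < q -> agree_outside A t s ->
    q <= gibbs beta h A s s -> q <= gibbs beta h A s t ->
  (f s - f t) ^+ 2 <= 2 / q * Var beta h A f s.
Proof.
move=> q0 ts qs qt; have [->|st] := eqVneq s t.
  by rewrite subrr expr0n mulr_ge0 ?Var_ge0 ?divr_ge0// ltW.
rewrite mulrAC ler_pdivlMr// VarE; set m0 := mean _ _ _ f s.
rewrite /mean (bigD1 s)//= (bigD1 t) 1?eq_sym//=; set X := \sum_(i | _) _.
have X0 : 0 <= X by apply: sumr_ge0 => u _; rewrite mulr_ge0 ?gibbs_ge0 ?sqr_ge0.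
have H1 := ler_wpM2r (sqr_ge0 (f s - m0)) qs.
have H2 := ler_wpM2r (sqr_ge0 (f t - m0)) qt.
have H3 : (f s - f t) ^+ 2 * q <= 2 * (q * (f s - m0) ^+ 2 + q * (f t - m0) ^+ 2).
  rewrite -mulrDr mulrCA mulrC ler_pM2l//.
  have := sqr_ge0 (f s + f t - 2 * m0); lra.
lra.
Qed.

(** Compare with the maximum [v] of [f] instead of its mean: $u\ln(u/v) - u + v \le (u-v)^2/v$, and
    $(\sqrt u+\sqrt v)^2 \le 4v$ because $u \le v$. *)
Lemma Ent_le_osc A f eta (k : R) : (forall s, 0 <= f s) ->
    (forall s t, agree_outside A s eta -> agree_outside A t eta ->
       (Num.sqrt (f s) - Num.sqrt (f t)) ^+ 2 <= k) ->
  ent A f eta <= 4 * k.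
Proof.
move=> f0 H; have ee := agree_outside_refl A eta.
have [s0 s0E smax] := @arg_maxP _ _ _ eta (fun s => agree_outside A s eta) f ee.
have k0 : 0 <= k by apply: le_trans (H _ _ ee ee); exact: sqr_ge0.
have [v0|v0] := eqVneq (f s0) 0.
  have fE s : agree_outside A s eta -> f s = 0.
    by move=> sE; apply/le_anti; rewrite f0 andbT -v0; exact: smax.
  rewrite (@eq_Ent _ _ _ _ _ _ _ _ _ (fun=> 0)) ?Ent_cst ?mulr_ge0//.
have {}v0 : 0 < f s0 by rewrite lt_neqAle eq_sym v0 f0.
apply: le_trans (Ent_le_relative _ _ _ _ f0 v0) _.
rewrite -[leRHS](mean_cst beta h A _ eta); apply: ler_mean => s sE.
have sv := smax s sE; set v := f s0 in v0 sv *; set u := f s in sv *.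
have u0 : 0 <= u by exact: f0.
apply: (@le_trans _ _ (u * (u / v - 1) - u + v)).
  rewrite !lerD2r; move: u0; rewrite le_eqVlt => /predU1P[<-|u0]; first by rewrite !mul0r.
  rewrite ler_pM2l// -ln_div//.
  have := le_ln1Dx (x := u / v - 1).
  have -> : 1 + (u / v - 1) = u / v by ring.
  by rewrite ltrBDl subrr divr_gt0// => /(_ isT).
have vE := sqr_sqrtr (ltW v0); have uE := sqr_sqrtr u0.
have -> : u * (u / v - 1) - u + v = (u - v) ^+ 2 / v by field; rewrite gt_eqF.
rewrite ler_pdivrMr// -{1}uE -vE.
have xk : (Num.sqrt u - Num.sqrt v) ^+ 2 <= k := H s s0 sE s0E.
have y0 : 0 < Num.sqrt v by rewrite sqrtr_gt0.
have xy : Num.sqrt u <= Num.sqrt v by rewrite ler_wsqrtr.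
have x0 := sqrtr_ge0 u; move: xk y0 xy x0.
set x : R := Num.sqrt u; set y : R := Num.sqrt v => xk y0 xy x0.
have -> : (x ^+ 2 - y ^+ 2) ^+ 2 = (x - y) ^+ 2 * (x + y) ^+ 2 by ring.
have -> : 4 * k * y ^+ 2 = k * (2 * y) ^+ 2 by ring.
apply: ler_pM; [exact: sqr_ge0|exact: sqr_ge0|exact: xk|].
by rewrite ler_pXn2r ?nnegrE//; lra.
Qed.

(** The 8 is 4 from [Ent_le_osc] times 2 from [sqr_sub_le_Var]; [n ^+ 2] comes from chaining [n]
    flips. One inverse of [gibbs_bound n] is for a flip, the other for bounding a variance at one
    configuration by its average. *)
Definition block_sobolev_constant n : R := 8 * (n%:R / gibbs_bound n) ^+ 2.

Lemma Ent_le_sum_Var A n f eta : 0 <= beta -> (0 < n)%N -> (#|A| <= n)%N ->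
    (forall s, 0 <= f s) ->
  ent A f eta <= block_sobolev_constant n *
    \sum_(y in A) mu A (Var beta h [set y] (fun s => Num.sqrt (f s))) eta.
Proof.
move=> b0 n0 An f0; set g := fun s => Num.sqrt (f s); set S := \sum_(y in A) _.
have q0 := gibbs_bound_gt0 n; set q := gibbs_bound n in q0.
have S0 : 0 <= S by apply: sumr_ge0 => y _; apply: mean_ge0 => s; exact: Var_ge0.
have SVar y s : y \in A -> agree_outside A s eta -> Var beta h [set y] g s <= S / q.
  move=> yA sE; rewrite ler_pdivlMr// /S (bigD1 y)//=.
  rewrite ler_wpDr//; first by apply: sumr_ge0 => z _; apply: mean_ge0 => t; exact: Var_ge0.
  rewrite /mean (bigD1 s)//= ler_wpDr//.
    by apply: sumr_ge0 => t _; rewrite mulr_ge0 ?gibbs_ge0 ?Var_ge0.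
  by rewrite mulrC ler_wpM2r ?Var_ge0// gibbs_ge.
pose k := Num.sqrt (2 / q * (S / q)).
have k0 : 0 <= k := sqrtr_ge0 _.
have k2 : k ^+ 2 = 2 / q * (S / q).
  by rewrite sqr_sqrtr// mulr_ge0 ?divr_ge0// ltW.
have osc s t : agree_outside A s eta -> agree_outside A t eta -> g s - g t <= n%:R * k.
  move=> sE tE; apply: (@le_trans _ _ (#|A|%:R * k)); last by rewrite ler_wpM2r// ler_nat.
  apply: lipschitz_chain; last by rewrite (agree_outside_subr _ tE).
  move=> y u v yA us uv; apply: le_trans (ler_norm _) _.
  have uE : agree_outside A u eta by apply: agree_outside_trans sE.
  rewrite -(@ler_pXn2r _ 2) ?nnegrE// real_normK ?num_real// k2.
  have c1 : (#|[set y]| <= n)%N by rewrite cards1.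
  apply: le_trans (sqr_sub_le_Var g q0 _ _ _) _.
  - by rewrite agree_outside_sym; exact: uv.
  - exact: gibbs_ge (agree_outside_refl _ _).
  - by apply: gibbs_ge => //; rewrite agree_outside_sym.
  by rewrite ler_wpM2l ?SVar// divr_ge0// ltW.
apply: le_trans (Ent_le_osc (k := (n%:R * k) ^+ 2) f0 _) _.
  move=> s t sE tE; rewrite -real_normK ?num_real// ler_pXn2r ?nnegrE ?mulr_ge0//.
  by rewrite ler_norml osc// andbT lerNl opprB osc.
by rewrite exprMn k2 /block_sobolev_constant -/q le_eqVlt; apply/orP; left; apply/eqP; field; rewrite gt_eqF.
Qed.

(** Sites of the block are given by words of length at most [l], so the bound is uniform in [x] and
    [m]. *)
Lemma card_block x l : (#|block x l| <= #|{: l.-bseq 'I_b}|)%N.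
Proof.
rewrite -cardsT.
apply: leq_trans (leq_imset_card (fun w : l.-bseq 'I_b => insubd x (x ++ w)) setT).
apply/subset_leq_card/fintype.subsetP => y.
rewrite in_set in_subtree_at => /andP[/andP[ym xy] yl].
have wP : (size (drop (size x) y) <= l)%N by rewrite size_drop leq_subLR ltnW.
apply/imsetP; exists (Bseq wP) => //; apply/val_inj.
have yE : x ++ drop (size x) y = y :> seq _.
  by move: xy; rewrite prefixE => /eqP {1}<-; rewrite cat_take_drop.
by rewrite /= yE insubdK// unfold_in; exact: size_bseq.
Qed.

Lemma block_entropy_le_dirichlet l f : 0 <= beta -> (forall s, 0 <= f s) ->
  block_entropy beta h l f <=
  block_sobolev_constant #|{: l.-bseq 'I_b}|.+1 * l%:R *
    dirichlet beta h (fun s => Num.sqrt (f s)).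
Proof.
move=> b0 f0; set n := _.+1; set g := fun s => _; pose root := restriction tau r m.
pose v y := mean_T beta h (Var beta h [set y] g).
have c0 : 0 <= block_sobolev_constant n by rewrite mulr_ge0 ?sqr_ge0.
have v0 y : 0 <= v y by apply: mean_ge0 => s; exact: Var_ge0.
rewrite -mulrA; apply: le_trans (ler_wpM2l c0 (sum_ancestors_le l v0)).
rewrite mulr_sumr; apply: ler_sum => x xT.
have BT : block x l \subset subtree.
  by apply/fintype.subsetP => y; rewrite in_set in_subtree_at inE => /andP[/andP[]].
apply: le_trans (ler_mean _ _ (fun s _ => Ent_le_sum_Var s b0 (ltn0Sn _) (leqW (card_block x l)) f0)) _.
rewrite meanZ ler_wpM2l// mean_sum le_eqVlt; apply/orP; left; apply/eqP.
apply: eq_big => [y|y yB]; first by rewrite in_set.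
exact: mean_tower.
Qed.

(** * The logarithmic Sobolev constant as an inequality for all functions *)

Lemma Ent_T_gt0 f : (forall s, 0 <= f s) -> (exists s s', f s <> f s') -> 0 < Ent_T beta h f.
Proof.
move=> f0 [s [t st]]; set root := restriction tau r m.
have H := Ent_hellinger beta h subtree root f0.
rewrite lt_neqAle Ent_ge0// andbT eq_sym; apply/negP => /eqP E.
rewrite [X in _ <= X]E in H.
have fE (w : Omega) : f w = mu subtree f root.
  have /eqP := @mean_eq0 _ _ beta h _ _ _ _ _ _ w (fun s => sqr_ge0 _)
     (le_anti (introT andP (conj H (mean_ge0 _ _ _ _ (fun s => sqr_ge0 _)))))
     (agree_outside_subtree w root).
  by rewrite sqrf_eq0 subr_eq0 eqr_sqrt ?mean_ge0// => /eqP.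
by apply: st; rewrite !fE.
Qed.

Lemma dirichlet_ge0 f : 0 <= dirichlet beta h f.
Proof.
by apply: sumr_ge0 => x _; apply: mean_ge0 => s; exact: Var_ge0.
Qed.

Lemma csob_ge (C : R) : 0 < C ->
    (forall f, (forall s, 0 <= f s) ->
       Ent_T beta h f <= C * dirichlet beta h (fun s => Num.sqrt (f s))) ->
  1 / C <= csob beta h tau r m.
Proof.
move=> C0 H; apply: lb_le_inf.
  (* The infimum is over a nonempty set: the indicator of a plus spin at the root is not
     constant. *)
  have nilP : (size (@nil 'I_b) <= m.+1)%N by [].
  have oT : (Bseq nilP : V) \in subtree by rewrite inE.
  pose root := restriction tau r m.
  have [s1 s1x _] := exists_spin true root oT; have [s2 s2x _] := exists_spin false root oT.
  pose f (s : Omega) : R := if s (Bseq nilP) then 1 else 0.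
  exists (dirichlet beta h (fun s => Num.sqrt (f s)) / Ent_T beta h f), f; split=> //.
    by move=> s; rewrite /f; case: ifP.
  by exists s1, s2; rewrite /f s1x s2x; apply/eqP; rewrite oner_eq0.
move=> q [f [f0 fne ->]]; have E0 := Ent_T_gt0 f0 fne.
by rewrite ler_pdivlMr// mulrAC mul1r ler_pdivrMr// mulrC H.
Qed.

Lemma csob_log_sobolev (C : R) f : 0 < C -> 1 / C <= csob beta h tau r m ->
  (forall s, 0 <= f s) ->
  Ent_T beta h f <= C * dirichlet beta h (fun s => Num.sqrt (f s)).
Proof.
move=> C0 HC f0; set root := restriction tau r m.
have [/existsP[s fs]|] := boolP [exists s, f s != f root]; last first.
  rewrite negb_exists => /forallP fc.
  rewrite /Ent_T Ent_cst; first by rewrite mulr_ge0 ?dirichlet_ge0// ltW.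
  by move=> s t _; move/negPn/eqP: (fc s) => ->; move/negPn/eqP: (fc t).
have fne : exists s s', f s <> f s' by exists s, root; apply/eqP.
have E0 := Ent_T_gt0 f0 fne.
have : 1 / C <= dirichlet beta h (fun s => Num.sqrt (f s)) / Ent_T beta h f.
  apply: le_trans HC _; apply: ge_inf; last by exists f; split.
  by exists 0 => q [g [g0 gne ->]]; rewrite divr_ge0 ?dirichlet_ge0// ltW// Ent_T_gt0.
by rewrite ler_pdivlMr// mulrAC mul1r ler_pdivrMr// mulrC.
Qed.

End BlockSobolev.

(** * Effect of one spin flip on averages over deep levels *)

Section SingleSiteIncrements.
Variables (R : realType) (b : nat) (beta h : R) (tau : tree b -> bool).
Variables (r : tree b) (m : nat).

Local Notation V := (vertex b m).
Local Notation Omega := (config tau r m).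
Local Notation mu := (mean beta h).
Local Notation ent := (Ent beta h).

Implicit Types (x y z : V) (A B D U : {set V}) (eta s t u v : Omega) (f g : Omega -> R).

(** With [c] the root of the mean at [s], the average at [t] of $(\sqrt f - c)^2$ is at least
    $(\sqrt N - c)^2$, since the mean of $\sqrt f$ is at most $\sqrt N$. Moving this average to [s]
    costs [k], and [Ent_hellinger] concludes. *)
Lemma sqr_sub_sqrt_mean_le A f s t (k : R) : (forall u, 0 <= f u) ->
    mu A (fun u => (Num.sqrt (f u) - Num.sqrt (mu A f s)) ^+ 2) t <=
      k * mu A (fun u => (Num.sqrt (f u) - Num.sqrt (mu A f s)) ^+ 2) s -> 0 <= k ->
  (Num.sqrt (mu A f t) - Num.sqrt (mu A f s)) ^+ 2 <= k * ent A f s.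
Proof.
move=> f0 H k0; have := le_trans H (ler_wpM2l k0 (Ent_hellinger beta h A s f0)).
apply: le_trans; set c := Num.sqrt (mu A f s).
have c0 : 0 <= c by exact: sqrtr_ge0.
set N := mu A f t; have N0 : 0 <= N by exact: mean_ge0.
set q := mu A (fun u => Num.sqrt (f u)) t.
have expand (z : R) : mu A (fun u => (Num.sqrt (f u) - z) ^+ 2) t = N - 2 * z * q + z ^+ 2.
  have -> : mu A (fun u => (Num.sqrt (f u) - z) ^+ 2) t =
      mu A (fun u => f u + (- (2 * z)) * Num.sqrt (f u) + z ^+ 2) t.
    by apply: eq_mean => u _; rewrite -{2}[f u]sqr_sqrtr//; ring.
  by rewrite !meanD meanZ mean_cst -/N -/q; ring.
have q0 : 0 <= q by apply: mean_ge0 => u; exact: sqrtr_ge0.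
have qN : q <= Num.sqrt N.
  rewrite -(ger0_norm q0) -sqrtr_sqr ler_wsqrtr//.
  have : 0 <= mu A (fun u => (Num.sqrt (f u) - q) ^+ 2) t.
    by apply: mean_ge0 => u; exact: sqr_ge0.
  by rewrite expand; lra.
have NE : Num.sqrt N ^+ 2 = N by rewrite sqr_sqrtr.
have cq := ler_wpM2l c0 qN.
by rewrite expand sqrrB NE -mulr_natl; lra.
Qed.

Lemma Var_le_sqr_osc A f s (k : R) :
    (forall t, agree_outside A t s -> (f t - f s) ^+ 2 <= k) ->
  Var beta h A f s <= k.
Proof.
move=> H; apply: (@le_trans _ _ (mu A (fun t => (f t - f s) ^+ 2) s)); last first.
  by rewrite -[leRHS](mean_cst beta h A k s); apply: ler_mean.
have -> : mu A (fun t => (f t - f s) ^+ 2) s =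
    mu A (fun t => f t ^+ 2 + (- (2 * f s)) * f t + f s ^+ 2) s.
  by apply: eq_mean => t _; ring.
rewrite !meanD meanZ mean_cst /Var.
have := sqr_ge0 (mu A f s - f s); rewrite sqrrB -mulr_natl; lra.
Qed.

(** Bounds the density between the two laws below a site for the two values of its spin; the square
    is the one in [mean_comparison]. *)
Definition kernel_ratio : R := expR (beta * site_bound b h) ^+ 2.

Lemma mean_subtree_below_le y f s t : 0 <= beta -> (forall u, 0 <= f u) ->
    independent_of [set y] f -> agree_outside [set y] s t ->
  mu (subtree_below y) f s <= kernel_ratio * mu (subtree_below y) f t.
Proof.
move=> b0 f0 fy st; apply: (mean_comparison (B := [set y])) => //.
  by rewrite disjoint_sym disjoints1 in_setD1 eqxx.
move=> u v uv; rewrite /weight -expRD ler_expR -mulrDr ler_wpM2l// -lerBlDr.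
exact: energy_lipschitz uv.
Qed.

(** The sites deeper than layer [j] split into the sets below each [y] of that layer; [g] is
    averaged over all of them but one, which makes these terms the summands of
    [Ent_superadditivity]. *)
Definition layer_entropy x j g y s : R :=
  ent (subtree_below y) (mu (level_ge x j.+1 :\: subtree_below y) g) s.

Lemma sum_layer_entropy_le x j g s : (forall u, 0 <= g u) ->
  \sum_(y <- layer x j) layer_entropy x j g y s <= ent (level_ge x j.+1) g s.
Proof.
move=> g0; rewrite /layer_entropy level_geS_bigcup.
apply: Ent_superadditivity => //; first exact: layer_uniq.
move=> y z yl zl yz.
apply: separatedSl (subtree_below_sub y) _; apply: separatedSr (subtree_below_sub z) _.
exact: layer_separated yl zl yz.
Qed.

(** A flip inside the averaged levels changes nothing, nor does one above layer [j], which is not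
    adjacent to them. For [y] in layer [j] only the law below [y] changes: the average over the
    rest, [E], does not see the spin at [y]. *)
Lemma sqr_sub_sqrt_level_mean_le x j g y s t :
    0 <= beta -> (forall u, 0 <= g u) ->
    independent_of (subtree_at x :\: level_ge x j.+1) g ->
    y \in subtree_at x -> agree_outside [set y] t s ->
  (Num.sqrt (mu (level_ge x j.+1) g t) - Num.sqrt (mu (level_ge x j.+1) g s)) ^+ 2 <=
  if y \in layer x j then kernel_ratio * layer_entropy x j g y s else 0.
Proof.
move=> b0 g0 gi yx ts; set S := level_ge x j.+1.
have gy : y \notin S -> independent_of [set y] g.
  by move=> yS; apply: indep_sub gi; rewrite sub1set in_setD yS.
have ym : (size y <= m)%N by move: yx; rewrite in_subtree_at => /andP[].
case: ifP => yl.
  move: (yl); rewrite mem_layer => /andP[_ /eqP yk].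
  have yS : y \notin S by rewrite in_level_ge yk negb_and -ltnNge addnS leqnn orbT.
  pose E := S :\: subtree_below y.
  have sep : separated (subtree_at y) E.
    apply: separated_subtree_at => v /setDP[]; rewrite in_level_ge addnS -yk.
    move=> /andP[vx yv]; rewrite in_subtree_below yv andbT => ->; split=> //; last exact: ltnW.
    by move: vx; rewrite in_subtree_at => /andP[].
  have ySub : subtree_below y \subset S.
    rewrite /S level_geS_bigcup bigcup_seq.
    by apply/fintype.subsetP => z zy; apply/bigcupP; exists y.
  have SE u : mu S g u = mu (subtree_below y) (mu E g) u.
    rewrite -mean_setU; last exact: separatedSl (subtree_below_sub y) sep.
    congr (mean _ _ _ _ _); apply/setP => z; rewrite in_setU [z \in E]in_setD.
    by case zy : (z \in subtree_below y) => //=; have /fintype.subsetP -> := ySub.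
  have E0 u : 0 <= mu E g u by exact: mean_ge0.
  have Ey : independent_of [set y] (mu E g).
    apply: mean_separated_indep; last exact: gy.
    apply: separated_sym; apply: separatedSl sep; rewrite sub1set in_subtree_at ym.
    exact: prefix_refl.
  rewrite !SE; apply: sqr_sub_sqrt_mean_le => //; last exact/exprn_ge0/expR_ge0.
  apply: mean_subtree_below_le => // [u|u v uv]; first exact: sqr_ge0.
  by rewrite (Ey u v).
suff -> : mu S g t = mu S g s by rewrite subrr expr0n.
have [yS|yS] := boolP (y \in S).
  by apply: mean_indep; apply: agree_outsideS ts; rewrite sub1set.
have yk : (size y < size x + j)%N.
  move: yS; rewrite in_level_ge yx /= -ltnNge addnS ltnS leq_eqVlt => /predU1P[yk|//].
  by move: yl; rewrite mem_layer yx yk eqxx.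
apply: (@mean_separated_indep _ _ beta h _ _ _ S [set y]) => //; last exact: gy.
move=> v z; rewrite in_level_ge addnS in_set1 => /andP[_ vk] /eqP ->.
have yv := ltn_trans yk vk; split; first by apply: contraTneq yv => ->; rewrite ltnn.
apply/negP => /orP[] /child_size E; move: yv vk yk; rewrite E; first by rewrite ltnNge leqnSn.
by move=> _; rewrite ltnS => H1 H2; move: (leq_ltn_trans H1 H2); rewrite ltnn.
Qed.

End SingleSiteIncrements.

(** * The subtree at a vertex as a complete tree of its own *)

Section Restriction.
Variables (R : realType) (b : nat) (beta h : R) (tau : tree b -> bool).
Variables (r : tree b) (m : nat) (x : vertex b m).
Hypothesis xm : (size x <= m)%N.

Local Notation V := (vertex b m).
Local Notation Omega := (config tau r m).
Local Notation V' := (vertex b (m - size x)).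
Local Notation Omega' := (config tau (r ++ x) (m - size x)).

Implicit Types (y z : V) (w : V').

Fact graft_subproof (w : V') : (size (x ++ w) <= m.+1)%N.
Proof. by rewrite size_cat -leq_subRL ?(leqW xm)// subSn// size_bseq. Qed.

Definition graft (w : V') : V := Bseq (graft_subproof w).

Fact ungraft_subproof (y : V) : (size (drop (size x) y) <= (m - size x).+1)%N.
Proof. by rewrite size_drop -subSn// leq_sub2r// size_bseq. Qed.

Definition ungraft (y : V) : V' := Bseq (ungraft_subproof y).

Lemma graftK : cancel graft ungraft.
Proof. by move=> w; apply/val_inj; rewrite /= drop_size_cat. Qed.

Lemma ungraftK y : prefix x y -> graft (ungraft y) = y.
Proof.
move=> xy; apply/val_inj => /=; move: xy; rewrite prefixE => /eqP {1}<-.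
exact: cat_take_drop.
Qed.

Lemma prefix_graft w : prefix x (graft w).
Proof. exact: prefix_prefix. Qed.

Lemma child_graft w w' : child (graft w) (graft w') = child w w'.
Proof. by apply: eq_existsb => i; rewrite /= rcons_cat eqseq_cat ?eqxx. Qed.

Lemma graft_subtree w : (graft w \in subtree_at x) = (w \in subtree).
Proof.
by rewrite in_subtree_at prefix_graft andbT inE /= size_cat -leq_subRL.
Qed.

Fact extend_subproof (eta : Omega) (s : Omega') :
  agrees_with_tau tau r [ffun y : V => if prefix x y then s (ungraft y) else eta y].
Proof.
apply/forall_inP => y yb; rewrite ffunE; case: (boolP (prefix x y)) => [xy|_]; last first.
  by have /forall_inP/(_ y yb) := configP eta.
have yb' : ungraft y \in outer_boundary.
  by move: yb; rewrite !inE /= size_drop => /eqP ->; rewrite subSn.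
have /forall_inP/(_ _ yb')/eqP -> := configP s.
have xyE : x ++ ungraft y = y :> seq _ by exact: (congr1 val (ungraftK xy)).
by rewrite -catA xyE.
Qed.

Definition extend (eta : Omega) (s : Omega') : Omega := Config (extend_subproof eta s).

Lemma extendE eta s y : extend eta s y = if prefix x y then s (ungraft y) else eta y.
Proof. by rewrite /= ffunE. Qed.

Lemma extend_graft eta s w : extend eta s (graft w) = s w.
Proof. by rewrite extendE prefix_graft graftK. Qed.

Fact shrink_subproof (s : Omega) :
  agrees_with_tau tau (r ++ x) [ffun w : V' => s (graft w)].
Proof.
apply/forall_inP => w wb; rewrite ffunE.
have wb' : graft w \in outer_boundary.
  by move: wb; rewrite !inE /= size_cat => /eqP ->; rewrite addnS subnKC.
have /forall_inP/(_ _ wb')/eqP -> := configP s.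
by rewrite catA.
Qed.

Definition shrink (s : Omega) : Omega' := Config (shrink_subproof s).

Lemma shrinkE s w : shrink s w = s (graft w).
Proof. by rewrite /= ffunE. Qed.

Lemma extend_agree eta s : agree_outside (subtree_at x) (extend eta s) eta.
Proof.
apply/agree_outsideP => y; rewrite in_subtree_at extendE negb_and.
case: (boolP (prefix x y)) => //= xy; rewrite orbF => ym.
have /agree_outsideP/(_ y) := agree_outside_subtree (extend eta s) eta.
by rewrite inE ym extendE xy => ->.
Qed.

Lemma sum_extend eta (F : Omega -> R) :
  \sum_(s | agree_outside (subtree_at x) s eta) F s = \sum_(s : Omega') F (extend eta s).
Proof.
rewrite (reindex_onto (extend eta) shrink) /=; last first.
  move=> s /agree_outsideP sE; apply: config_eqP => y; rewrite extendE.
  case: (boolP (prefix x y)) => xy; first by rewrite shrinkE ungraftK.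
  by rewrite sE// in_subtree_at negb_and xy orbT.
apply: eq_bigl => s; rewrite extend_agree /=; apply/eqP/config_eqP => w.
by rewrite shrinkE extend_graft.
Qed.

(** Edges whose parent lies below or at [x] match those of the smaller tree and cancel. Among the
    others only the edge from the parent of [x] to [x] sees [s] and [t], and it varies by at most
    2. *)
Lemma energyT_extend_sub eta (s t : Omega') :
  (energy h setT (extend eta s) - energy h setT s)
  - (energy h setT (extend eta t) - energy h setT t) <= 2.
Proof.
have dE (u : Omega') : energy h setT (extend eta u) - energy h setT u =
    \sum_(p : V * V | child p.1 p.2 && ~~ prefix x p.1)
       spin R (extend eta u p.1) * spin R (extend eta u p.2)
    + h * \sum_(y : V | ~~ prefix x y) spin R (eta y).
  rewrite !energyTE (bigID (fun p : V * V => prefix x p.1)) /=.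
  rewrite (bigID (fun y : V => prefix x y) predT) /=.
  have -> : \sum_(p : V * V | child p.1 p.2 && prefix x p.1)
       spin R (extend eta u p.1) * spin R (extend eta u p.2) =
     \sum_(q : V' * V' | child q.1 q.2) spin R (u q.1) * spin R (u q.2).
    rewrite (reindex_onto (fun q : V' * V' => (graft q.1, graft q.2))
        (fun p : V * V => (ungraft p.1, ungraft p.2))) /=; last first.
      move=> [y z] /= /andP[yz xy]; rewrite !ungraftK//.
      by apply: prefix_trans xy (child_prefix yz).
    apply: eq_big => [[w w']|[w w'] _] /=; last by rewrite !extend_graft.
    by rewrite !graftK eqxx andbT child_graft prefix_graft andbT.
  have -> : \sum_(y : V | prefix x y) spin R (extend eta u y) = \sum_(w : V') spin R (u w).
    rewrite (reindex_onto graft ungraft) /=; last by move=> y; exact: ungraftK.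
    apply: eq_big => [w|w _]; last by rewrite extend_graft.
    by rewrite prefix_graft graftK eqxx.
  have -> : \sum_(y : V | ~~ prefix x y) spin R (extend eta u y) =
      \sum_(y : V | ~~ prefix x y) spin R (eta y).
    by apply: eq_bigr => y /negPf xy; rewrite extendE xy.
  by ring.
rewrite !dE opprD addrACA subrr addr0 -sumrB.
apply: le_trans (sum_edges_to_le R x).
rewrite big_mkcond [leRHS]big_mkcond /=; apply: ler_sum => -[y z] _ /=.
case: (boolP (child y z)) => //= yz; case: (boolP (prefix x y)) => xy /=; first by case: ifP.
rewrite !(extendE _ _ y) (negPf xy).
case: eqP => [_|zx]; first by rewrite (le_trans (ler_norm _))// spinM_sub_le.
rewrite !extendE; case: (boolP (prefix x z)) => xz; last by rewrite subrr.
exfalso; apply: zx.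
have zs := child_size yz; have xzs := size_prefix xz.
apply/esym; apply: (prefix_size_eq xz (prefix_refl z)).
apply/eqP; rewrite eqn_leq xzs /= zs ltnNge.
by apply: contra xy => xys; apply: prefix_child yz xys xz.
Qed.

Definition restriction_ratio : R := expR (beta * 2).

Lemma weight_extend_cross eta (s t : Omega') : 0 <= beta ->
  weight beta h setT (extend eta s) * weight beta h setT t <=
  restriction_ratio * (weight beta h setT s * weight beta h setT (extend eta t)).
Proof.
move=> b0; rewrite /weight -!expRD ler_expR -!mulrDr ler_wpM2l//.
by have := energyT_extend_sub eta s t; lra.
Qed.

Lemma mean_subtreeE (F : Omega' -> R) eta : mean beta h subtree F eta =
  (\sum_(s : Omega') weight beta h setT s * F s) / \sum_(s : Omega') weight beta h setT s.
Proof.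
rewrite meanE /partition_function.
by congr (_ / _); apply: eq_bigl => s; rewrite agree_outside_subtree.
Qed.

Lemma mean_extendE (F : Omega -> R) eta : mean beta h (subtree_at x) F eta =
  (\sum_(s : Omega') weight beta h setT (extend eta s) * F (extend eta s)) /
  \sum_(s : Omega') weight beta h setT (extend eta s).
Proof. by rewrite meanE /partition_function !sum_extend. Qed.

Lemma mean_le_restriction (F : Omega -> R) eta eta' : 0 <= beta -> (forall s, 0 <= F s) ->
  mean beta h (subtree_at x) F eta <=
  restriction_ratio * mean beta h (@subtree b (m - size x)) (F \o extend eta) eta'.
Proof.
move=> b0 F0; rewrite mean_extendE mean_subtreeE.
apply: (@weighted_mean_le R Omega' predT (fun s => weight beta h setT (extend eta s))
  (fun s => weight beta h setT s) (F \o extend eta) restriction_ratio).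
- by exists eta'.
- by move=> s; exact: weight_gt0.
- by move=> s; exact: weight_gt0.
- by move=> s; exact: F0.
- by move=> s t _ _; exact: (weight_extend_cross eta s t b0).
Qed.

Lemma restriction_le_mean (F : Omega -> R) eta eta' : 0 <= beta -> (forall s, 0 <= F s) ->
  mean beta h (@subtree b (m - size x)) (F \o extend eta) eta' <=
  restriction_ratio * mean beta h (subtree_at x) F eta.
Proof.
move=> b0 F0; rewrite mean_extendE mean_subtreeE.
apply: (@weighted_mean_le R Omega' predT _ (fun s => weight beta h setT (extend eta s))).
- by exists eta'.
- by move=> s; exact: weight_gt0.
- by move=> s; exact: weight_gt0.
- by move=> s; exact: F0.
- by move=> s t _ _; rewrite mulrC [X in _ <= _ * X]mulrC; exact: (weight_extend_cross eta t s b0).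
Qed.

(* The entropy is the minimum over [v] of the mean of the nonnegative function
   [f ln (f / v) - f + v], so a change of measure with bounded density costs
   only a constant factor. *)
Lemma Ent_le_restriction (F : Omega -> R) eta eta' : 0 <= beta -> (forall s, 0 <= F s) ->
  Ent beta h (subtree_at x) F eta <=
  restriction_ratio * Ent beta h (@subtree b (m - size x)) (F \o extend eta) eta'.
Proof.
move=> b0 F0; set v := mean beta h subtree (F \o extend eta) eta'.
have F0' s : 0 <= (F \o extend eta) s by exact: F0.
have [v0|v0] := eqVneq v 0.
  have FE s : agree_outside (subtree_at x) s eta -> F s = 0.
    move=> sE; have k0 : 0 <= restriction_ratio by exact: expR_ge0.
    apply: (@mean_eq0 _ _ beta h _ _ _ (subtree_at x) F eta s F0 _ sE).
    apply/eqP; rewrite eq_le (mean_ge0 beta h _ eta F0) andbT.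
    by apply: le_trans (mean_le_restriction eta eta' b0 F0) _; rewrite -/v v0 mulr0.
  rewrite (eq_Ent _ _ FE) Ent_cst//.
  by apply: mulr_ge0; [exact: expR_ge0|exact: Ent_ge0].
have {}v0 : 0 < v by rewrite lt_neqAle eq_sym v0 mean_ge0.
apply: le_trans (Ent_le_relative _ _ _ _ F0 v0) _.
have rel0 s : 0 <= F s * (ln (F s) - ln v) - F s + v.
  by have := sub_le_mulr_subln (F0 s) v0; lra.
apply: le_trans (mean_le_restriction eta eta' b0 rel0) _.
rewrite ler_wpM2l ?expR_ge0// EntE.
rewrite [leLHS](_ : _ = mean beta h subtree
   (fun s => (F \o extend eta) s * (ln ((F \o extend eta) s) - ln v)) eta'); last first.
  have /= := @meanD _ _ beta h _ _ _ (@subtree b (m - size x))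
    (fun s => F (extend eta s) * (ln (F (extend eta s)) - ln v) - F (extend eta s)) (fun=> v) eta'.
  rewrite mean_cst meanB -/v subrK; exact.
by apply: ler_mean => s sE; rewrite (mean_indep _ _ _ sE) -/v.
Qed.

Lemma extend_agree_site eta (s t : Omega') w :
  agree_outside [set w] s t -> agree_outside [set graft w] (extend eta s) (extend eta t).
Proof.
move=> /agree_outsideP st; apply/agree_outsideP => y; rewrite in_set1 => yw.
rewrite !extendE; case: (boolP (prefix x y)) => // xy.
rewrite st// in_set1; apply: contra yw => /eqP <-.
by rewrite ungraftK.
Qed.

End Restriction.

(** * Geometric decay of entropy from a uniform logarithmic Sobolev inequality *)

Section EntropyDecay.
Variables (R : realType) (b : nat) (beta h : R) (tau : tree b -> bool) (C : R).
Hypotheses (beta0 : 0 <= beta) (C0 : 0 < C).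
Hypothesis log_sobolev : forall (r : tree b) (m : nat) (f : config tau r m -> R),
  (forall s, 0 <= f s) ->
  Ent_T beta h f <= C * dirichlet beta h (fun s => Num.sqrt (f s)).

(** Two changes of measure, to the smaller tree and back, one use of the logarithmic Sobolev
    inequality there, and one factor for the flip increments. It depends on neither the root nor the
    depth. *)
Definition decay_constant : R := restriction_ratio beta ^+ 2 * C * kernel_ratio b beta h.

Lemma decay_constant_gt0 : 0 < decay_constant.
Proof. by rewrite !mulr_gt0 ?exprn_gt0 ?expR_gt0. Qed.

Variables (r : tree b) (m : nat).

Local Notation V := (vertex b m).
Local Notation Omega := (config tau r m).
Local Notation mu := (mean beta h).
Local Notation ent := (Ent beta h).

Implicit Types (x y : V) (eta s : Omega) (f g : Omega -> R).

Lemma Ent_level_mean_le x j g eta : x \in subtree -> (forall s, 0 <= g s) ->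
    independent_of (subtree_at x :\: level_ge x j.+1) g ->
  ent (subtree_at x) (mu (level_ge x j.+1) g) eta <=
  decay_constant * mu (subtree_at x) (ent (level_ge x j.+1) g) eta.
Proof.
move=> xT g0 gi; have xm : (size x <= m)%N by move: xT; rewrite inE.
set S := level_ge x j.+1; set G := mu S g; pose root := restriction tau (r ++ x) (m - size x).
have G0 s : 0 <= G s by exact: mean_ge0.
have entS0 s : 0 <= ent S g s by exact: Ent_ge0.
have k0 : 0 <= restriction_ratio beta by exact: expR_ge0.
have M0 : 0 <= kernel_ratio b beta h by exact/exprn_ge0/expR_ge0.
apply: le_trans (Ent_le_restriction h xm eta root beta0 G0) _.
have -> (z : R) : decay_constant * z = restriction_ratio beta *
    (C * (kernel_ratio b beta h * (restriction_ratio beta * z))).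
  by rewrite /decay_constant; ring.
apply: ler_wpM2l => //.
have LS := @log_sobolev _ _ (G \o extend xm eta) (fun=> G0 _).
apply: le_trans LS _.
apply: ler_wpM2l; first exact: ltW.
(* Compare the Dirichlet form pointwise: only flips in layer [j] contribute, and superadditivity
   sums their contributions to one conditional entropy. *)
apply: (@le_trans _ _ (kernel_ratio b beta h *
    mean beta h subtree (ent S g \o extend xm eta) root)); last first.
  by apply: ler_wpM2l => //; exact: restriction_le_mean.
rewrite -meanZ /dirichlet -mean_sum; apply: ler_mean => s _.
apply: (@le_trans _ _ (\sum_(w in @subtree b (m - size x))
   if graft xm w \in layer x j
   then kernel_ratio b beta h * layer_entropy beta h x j g (graft xm w) (extend xm eta s)
   else 0)).
  apply: ler_sum => w wT; apply: Var_le_sqr_osc => t ts.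
  apply: sqr_sub_sqrt_level_mean_le => //; first by rewrite graft_subtree.
  exact: extend_agree_site.
apply: (le_trans _ (ler_wpM2l M0 (sum_layer_entropy_le beta h x j (extend xm eta s) g0))).
rewrite -big_mkcondr /= -mulr_sumr ler_wpM2l//.
rewrite /layer big_filter big_enum_cond /=.
rewrite [leRHS](reindex_onto (graft xm) (ungraft xm)) /=; last first.
  by move=> y; rewrite in_subtree_at => /andP[/andP[_ xy] _]; exact: ungraftK.
rewrite le_eqVlt; apply/orP; left; apply/eqP; apply: eq_bigl => w.
by rewrite mem_layer graftK eqxx andbT graft_subtree andbA andbb.
Qed.

(** By the chain rule the entropy of [g] is [Y + X], and [X <= L Y] is equivalent to
    [X <= L / (1 + L) (X + Y)]. *)
Lemma Ent_level_mean_contract x j g eta : x \in subtree -> (forall s, 0 <= g s) ->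
    independent_of (subtree_at x :\: level_ge x j.+1) g ->
  ent (subtree_at x) (mu (level_ge x j.+1) g) eta <=
  decay_constant / (1 + decay_constant) * ent (subtree_at x) g eta.
Proof.
move=> xT g0 gi; have := Ent_level_mean_le eta xT g0 gi.
have S_sub : level_ge x j.+1 \subset subtree_at x by rewrite -level_ge0 level_ge_sub.
rewrite (Ent_chain _ _ g eta S_sub).
have L0 := decay_constant_gt0; set L := decay_constant in L0 *.
set X := ent _ (mean _ _ _ _) _; set Y := mean _ _ _ _ _ => XY.
rewrite mulrAC ler_pdivlMr; first by lra.
by rewrite addr_gt0.
Qed.

(** Each further level of averaging gains one factor [rho]; the contraction is applied to the
    average of [f] over distances at least [k + 2]. *)
Lemma Ent_below_le_expn x l f eta : x \in subtree -> (forall s, 0 <= f s) ->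
    independent_of (block x l) f ->
  ent (subtree_at x) (mu (subtree_below x) f) eta <=
  (decay_constant / (1 + decay_constant)) ^+ l * ent (subtree_at x) f eta.
Proof.
move=> xT f0 fi; have L0 := decay_constant_gt0.
set rho := decay_constant / _; have rho0 : 0 <= rho by rewrite divr_ge0 ?addr_ge0// ltW.
suff H k : (k <= l)%N -> ent (subtree_at x) (mu (subtree_below x) f) eta <=
    rho ^+ k * ent (subtree_at x) (mu (level_ge x k.+1) f) eta.
  apply: le_trans (H l (leqnn l)) _; rewrite ler_wpM2l ?exprn_ge0//.
  have S_sub : level_ge x l.+1 \subset subtree_at x by rewrite -level_ge0 level_ge_sub.
  rewrite [leRHS](Ent_chain _ _ f eta S_sub) lerDr mean_ge0// => s.
  exact: Ent_ge0.
elim: k => [|k IH] kl; first by rewrite expr0 mul1r level_ge1.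
apply: le_trans (IH (ltnW kl)) _; rewrite exprSr -mulrA ler_wpM2l ?exprn_ge0//.
have fE s : mu (level_ge x k.+1) (mu (level_ge x k.+2) f) s = mu (level_ge x k.+1) f s.
  exact/mean_tower/level_ge_sub.
rewrite -(eq_Ent _ _ (fun s _ => fE s)).
apply: Ent_level_mean_contract => // [s|]; first exact: mean_ge0.
have in_lo y : y \in subtree_at x :\: level_ge x k.+1 ->
    (y \in subtree_at x) && (size y <= size x + k)%N.
  by rewrite in_setD in_level_ge => /andP[+ yx]; rewrite yx /= -ltnNge addnS ltnS.
(* Sites at distance at most [k] are not adjacent to those at distance at least [k + 2], and they
   lie in the block because [k < l]. *)
apply: mean_separated_indep.
  move=> v y; rewrite in_level_ge => /andP[_ vk] /in_lo/andP[_ yk].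
  have yv : ((size y).+1 < size v)%N by apply: leq_trans vk; rewrite !addnS !ltnS.
  split; first by apply: contraTneq yv => ->; rewrite -leqNgt leqnSn.
  apply/negP => /orP[] /child_size E; move: yv; rewrite E ?ltnn//.
  by rewrite ltnNge !leqW.
apply: indep_sub fi; apply/fintype.subsetP => y /in_lo/andP[yx yk].
by rewrite in_set yx (leq_ltn_trans yk)// ltn_add2l.
Qed.

End EntropyDecay.

(** * The three implications, with constants uniform in the subtree *)

Theorem theorem3p4 (R : realType) (b : nat) (beta h : R) (tau : tree b -> bool)
    (hb : (2 <= b)%N) (hbeta : 0 <= beta) :
  [/\ (forall (l : nat) (delta : R) (r : tree b) (m : nat),
        (1 <= l)%N -> 0 < delta <= 1 ->
        entropy_mixing beta h tau r m l
          (((1 - delta) * pmin beta h tau r m / (l%:R + 1 - delta)) ^+ 2) ->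
        forall f : config tau r m -> R, (forall s, 0 <= f s) ->
          Ent_T beta h f <= 2 / delta * block_entropy beta h l f),
      ((exists (l : nat) (delta : R),
          [/\ (1 <= l)%N, 0 < delta <= 1 &
              forall (r : tree b) (m : nat),
                entropy_mixing beta h tau r m l
                  (((1 - delta) * pmin beta h tau r m
                      / (l%:R + 1 - delta)) ^+ 2)]) ->
        exists2 C : R, 0 < C &
          forall (r : tree b) (m : nat), 1 / C <= csob beta h tau r m) &
      ((exists2 C : R, 0 < C &
          forall (r : tree b) (m : nat), 1 / C <= csob beta h tau r m) ->
        exists c theta : R,
          [/\ 0 < c, 0 < theta &
              forall (r : tree b) (m l : nat),
                entropy_mixing beta h tau r m l
                  (c * expR (- (theta * l%:R)))])].
Proof.
split.
- by move=> l delta r m l1 d01 EM f f0; exact: Ent_T_le_block_entropy.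
(* Each block entropy is bounded by local variances and each site lies in at most [l] blocks; hence
   the constant [K]. *)
- move=> [l [delta [l1 d01 EM]]]; have /andP[d0 _] := d01.
  pose K := block_sobolev_constant b beta h #|{: l.-bseq 'I_b}|.+1 * l%:R.
  have K0 : 0 < K.
    rewrite mulr_gt0 ?ltr0n// /block_sobolev_constant mulr_gt0// exprn_gt0//.
    by rewrite divr_gt0// gibbs_bound_gt0.
  have dK0 : 0 < 2 / delta * K by rewrite mulr_gt0// divr_gt0.
  exists (2 / delta * K) => // r m; apply: csob_ge => // f f0.
  apply: le_trans (Ent_T_le_block_entropy l1 d01 (EM r m) f0) _.
  rewrite -[leRHS]mulrA ler_wpM2l ?divr_ge0 ?(ltW d0)//.
  exact: block_entropy_le_dirichlet.
move=> [C C0 HC].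
have LS r m (f : config tau r m -> R) : (forall s, 0 <= f s) ->
    Ent_T beta h f <= C * dirichlet beta h (fun s => Num.sqrt (f s)).
  by move=> f0; apply: csob_log_sobolev.
have L0 := decay_constant_gt0 b beta h C0; set L := decay_constant _ _ _ _ in L0.
pose rho := L / (1 + L).
have rho0 : 0 < rho by rewrite divr_gt0// addr_gt0.
have rho1 : rho < 1 by rewrite ltr_pdivrMr ?addr_gt0// mul1r ltrDr.
(* With this rate, $e^{-\vartheta l}$ is exactly [rho ^+ l], and [rho < 1] makes the rate
   positive. *)
exists 1, (- ln rho); split=> //; first by rewrite oppr_gt0 ln_lt0// rho0.
move=> r m l x eta f xT f0 fi.
rewrite mul1r mulNr opprK expRM_natr lnK ?posrE//.
exact: Ent_below_le_expn.
Qed.
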